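(* By storing $O(1)$ additional information at each vertex, there exists a deterministic $1$-local $O(1)$-memory routing algorithm on $G_9$ and on $G_{12}$ such that for every finite point set $P$ in general position and all $u,w\in P$ with $w$ in a positive cone of $u$, the path followed has length at most (i) $3\cdot 2\cdot|uw|=6|uw|$ when routing from $u$ to $w$, and (ii) $3\cdot\tfrac{5}{\sqrt{3}}\cdot|uw|$ when routing from $w$ to $u$.
   Context: Cones: for a point $u$, the plane is partitioned into six cones with apex $u$, bounded by the rays from $u$ at angles $j\pi/3$ ($j=0,\dots,5$) from the positive $x$-axis; counterclockwise from the positive $x$-axis they are $\overline{C}_1, C_0, \overline{C}_2, C_1, \overline{C}_0, C_2$; $C_0,C_1,C_2$ are positive and the others negative. General position: no two points of $P$ lie on a line parallel to a cone boundary ray. Half-$\theta_6$-graph $H$ of $P$: for each $u$ and each positive cone $C$ of $u$ containing other points, add an edge from $u$ to the point of $P$ in $C$ whose orthogonal projection onto the bisector of $C$ is closest to $u$; edges weighted by Euclidean length. Every edge of $H$ joins $u$ to a point $v$ in a negative cone of $u$. For a vertex $u$ and negative cone $\overline{C}$ of $u$, let $v_1,\dots,v_r$ be the neighbours of $u$ in $H$ lying in $\overline{C}$ in angular order around $u$; since $H$ is internally triangulated, consecutive $v_i,v_{i+1}$ are adjacent in $H$, and the path $v_1v_2\cdots v_r$ is the canonical path of $u$ in $\overline{C}$. Graph $G_{12}$: the subgraph of $H$ keeping, for every $u$ and negative cone $\overline{C}$ of $u$, the edges from $u$ to the first and last of its neighbours in $\overline{C}$ in clockwise order and to the neighbour in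 $\overline{C}$ whose orthogonal projection onto the bisector of $\overline{C}$ is closest to $u$. Graph $G_9$: the subgraph of $H$ keeping, for every $u$ and negative cone $\overline{C}$ of $u$, the edge from $u$ to the closest (by projection onto the bisector of $\overline{C}$) neighbour in $\overline{C}$, together with all edges of the canonical path of $u$ in $\overline{C}$. Routing model: vertices identified by coordinates; each vertex $s$ stores its neighbourhood in the graph plus $O(1)$ units of additional information (computed from $H$); a deterministic $1$-local $m$-memory routing algorithm forwards a message from the current vertex $s$ to a neighbour of $s$ in the graph as a deterministic function of $s$, the destination $t$, the information stored at $s$ (neighbours with coordinates and the additional information), and a memory of $m$ units stored with the message (a unit being a $\lceil\log_2 n\rceil$-bit integer or a point of $\mathbb{R}^2$), which it may update. Path length is the sum of Euclidean edge lengths traversed until reaching the destination. *)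

(* Defs.v *)
From Stdlib Require Import Reals Lra Lia List Arith.
Import ListNotations.
Open Scope R_scope.

Definition point := (R * R)%type.

Definition vsub (v u : point) : point := (fst v - fst u, snd v - snd u).
Definition cross (a b : point) : R := fst a * snd b - snd a * fst b.
Definition dot (a b : point) : R := fst a * fst b + snd a * snd b.
Definition dist (p q : point) : R :=
  sqrt ((fst p - fst q) ^ 2 + (snd p - snd q) ^ 2).

Definition ray (j : nat) : point := (cos (INR j * PI / 3), sin (INR j * PI / 3)).

(** Open sector k (k = 0..5) with apex u: strictly between rays k and k+1.
    Counterclockwise from the positive x-axis the sectors are
    0 = C̄1, 1 = C0, 2 = C̄2, 3 = C1, 4 = C̄0, 5 = C2.
    (Under general position no other point of P lies on a boundary ray.) *)
Definition in_sector (k : nat) (u v : point) : Prop :=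
  0 < cross (ray k) (vsub v u) /\ 0 < cross (vsub v u) (ray (S k)).

Definition positive_sector (k : nat) : Prop := k = 1%nat \/ k = 3%nat \/ k = 5%nat.
Definition negative_sector (k : nat) : Prop := k = 0%nat \/ k = 2%nat \/ k = 4%nat.

Definition bisector (k : nat) : point :=
  (cos ((2 * INR k + 1) * PI / 6), sin ((2 * INR k + 1) * PI / 6)).

Definition proj (k : nat) (u v : point) : R := dot (vsub v u) (bisector k).

Definition general_position (P : list point) : Prop :=
  forall p q, In p P -> In q P -> p <> q ->
    forall j, (j < 3)%nat -> cross (vsub q p) (ray j) <> 0.

Definition H_dir (P : list point) (u v : point) : Prop :=
  In u P /\ In v P /\
  exists k, positive_sector k /\ in_sector k u v /\
    forall x, In x P -> in_sector k u x -> proj k u v <= proj k u x.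

Definition H_edge (P : list point) (u v : point) : Prop := H_dir P u v \/ H_dir P v u.

Definition nbr_in (P : list point) (u : point) (k : nat) (v : point) : Prop :=
  H_edge P u v /\ in_sector k u v.

Definition ang_lt (u a b : point) : Prop := 0 < cross (vsub a u) (vsub b u).

Definition extreme_nbr (P : list point) (u : point) (k : nat) (v : point) : Prop :=
  nbr_in P u k v /\
  ((forall x, nbr_in P u k x -> x <> v -> ang_lt u x v) \/
   (forall x, nbr_in P u k x -> x <> v -> ang_lt u v x)).

Definition closest_nbr (P : list point) (u : point) (k : nat) (v : point) : Prop :=
  nbr_in P u k v /\ forall x, nbr_in P u k x -> proj k u v <= proj k u x.

(** a, b are consecutive (in angular order) on the canonical path of u in sector k. *)
Definition consec (P : list point) (u : point) (k : nat) (a b : point) : Prop :=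
  nbr_in P u k a /\ nbr_in P u k b /\ ang_lt u a b /\
  ~ (exists x, nbr_in P u k x /\ ang_lt u a x /\ ang_lt u x b).

Definition G12 (P : list point) (a b : point) : Prop :=
  H_edge P a b /\
  exists u v k, negative_sector k /\ ((u = a /\ v = b) \/ (u = b /\ v = a)) /\
    (extreme_nbr P u k v \/ closest_nbr P u k v).

Definition G9 (P : list point) (a b : point) : Prop :=
  H_edge P a b /\
  ((exists u v k, negative_sector k /\ ((u = a /\ v = b) \/ (u = b /\ v = a)) /\
      closest_nbr P u k v) \/
   (exists u k, negative_sector k /\ (consec P u k a b \/ consec P u k b a))).

(** A unit of storage: a ceil(log2 n)-bit integer, or a point (vertex coordinates). *)
Inductive unit_ : Type := UNat (m : nat) | UPt (p : point).

Definition valid_unit (P : list point) (x : unit_) : Prop :=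
  match x with
  | UNat m => (m < 2 ^ Nat.log2_up (length P))%nat
  | UPt p => In p P
  end.

Definition valid_units (P : list point) (c : nat) (l : list unit_) : Prop :=
  (length l <= c)%nat /\ Forall (valid_unit P) l.

(** A deterministic 1-local routing algorithm with preprocessing:
    [info P s] is the additional information stored at vertex s (computed
    from the point set, hence from H); [step s t N I M] returns the next
    vertex and the new memory, given the current vertex s, the destination t,
    the neighbourhood N of s in the graph, the information I stored at s and
    the memory M carried with the message. *)
Record algorithm : Type := {
  info : list point -> point -> list unit_;
  step : point -> point -> (point -> Prop) -> list unit_ -> list unit_ ->
         point * list unit_ }.

Fixpoint run (G : list point -> point -> point -> Prop) (A : algorithm)
    (P : list point) (s t : point) (k : nat) : point * list unit_ :=
  match k with
  | O => (s, [])
  | S k' =>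
      let st := run G A P s t k' in
      step A (fst st) t (G P (fst st)) (info A P (fst st)) (snd st)
  end.

Fixpoint path_length (G : list point -> point -> point -> Prop) (A : algorithm)
    (P : list point) (s t : point) (N : nat) : R :=
  match N with
  | O => 0
  | S k => path_length G A P s t k +
           dist (fst (run G A P s t k)) (fst (run G A P s t (S k)))
  end.

Definition routes_within (G : list point -> point -> point -> Prop) (A : algorithm)
    (cmem : nat) (P : list point) (s t : point) (L : R) : Prop :=
  exists N : nat,
    fst (run G A P s t N) = t /\
    (forall k, (k < N)%nat -> fst (run G A P s t k) <> t) /\
    (forall k, (k < N)%nat ->
       G P (fst (run G A P s t k)) (fst (run G A P s t (S k))) /\
       valid_units P cmem (snd (run G A P s t (S k)))) /\
    path_length G A P s t N <= L.

Definition routing_claim (G : list point -> point -> point -> Prop) : Prop :=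
  exists (cinfo cmem : nat) (A : algorithm),
    forall P : list point, NoDup P -> general_position P ->
      (forall s, In s P -> valid_units P cinfo (info A P s)) /\
      (forall u w, In u P -> In w P ->
         (exists k, positive_sector k /\ in_sector k u w) ->
         routes_within G A cmem P u w (3 * 2 * dist u w) /\
         routes_within G A cmem P w u (3 * (5 / sqrt 3) * dist u w)).

(* Main.v *)
(** In the coordinates [h 0, h 1, h 2] (rescaled projections on the bisectors of
    the positive cones, of sum zero) cones become order conditions: [v] lies in
    cone [i] of [u] iff the two other coordinates of [v] are smaller. In the
    half-theta-6-graph every vertex has at most one parent per cone, and the
    children of [u] in a negative cone form a path, monotone in both coordinates.

    Every vertex stores its parents, its closest and its first children and its
    siblings, so neighbourhoods are not consulted and one algorithm serves both
    graphs. Towards [t] in positive cone [i] of [s], go to the parent in that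
    cone. If [t] lies in negative cone [i] of [s], the triangle with apex [t]
    through [s] meets the cones [j] and [k] of [s] in two smaller triangles. If
    the one in cone [k] is empty (the larger one, if both are), go to the last
    child in direction [k] not beyond
    [t], or, if the children all lie beyond [t], to the parent in cone [j]; the
    emptiness persists. If none is empty, go to the closest child, or, if there
    is no child, to the parent on the shorter side.

    Moving along an edge through the closest child costs at most three times the
    side of the triangle of that edge. If [A] is the side of the triangle of [s]
    and [t] and [B], [C] are the sides of the two smaller triangles, three times
    [A + max B C], [A + B] (with [C] empty) and [2 A + min B C] bound the cost of
    the three situations; they are at most [6 |st|] and [5 sqrt 3 |st|]. *)

From Stdlib Require Import Reals List Lra Lia Arith.
From Stdlib Require Import Classical ClassicalEpsilon FunctionalExtensionality.
(* After [Reals], which exports another [dist]. *)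
Require Import Defs.
Import ListNotations.
Open Scope R_scope.

(** * Coordinates adapted to the cones *)

Inductive idx := I0 | I1 | I2.

(** Rescaled projections on the bisectors of the three positive cones: the
    side of the equilateral triangle spanned in cone [i] by [u] and [v] is
    [h i v - h i u]. *)
Definition h (i : idx) (p : point) : R :=
  match i with
  | I0 => 2 / sqrt 3 * snd p
  | I1 => - fst p - snd p / sqrt 3
  | I2 => fst p - snd p / sqrt 3
  end.

Definition perm (i j k : idx) : Prop := i <> j /\ i <> k /\ j <> k.

Definition third (i k : idx) : idx :=
  match i, k with
  | I0, I1 | I1, I0 => I2
  | I0, _ | _, I0 => I1
  | _, _ => I0
  end.

Lemma perm_third i k : i <> k -> perm i (third i k) k.
Proof. destruct i, k; unfold perm; simpl; intuition congruence. Qed.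

Lemma third_perm i j k : perm i j k -> third i k = j.
Proof. unfold perm; destruct i, j, k; simpl; intuition congruence. Qed.

Lemma perm_swap i j k : perm i j k -> perm i k j.
Proof. unfold perm; intuition. Qed.

Lemma perm_rot i j k : perm i j k -> perm j k i.
Proof. unfold perm; intuition. Qed.

Lemma perm_cover i j k l : perm i j k -> l = i \/ l = j \/ l = k.
Proof. unfold perm; destruct i, j, k, l; intuition congruence. Qed.

Lemma exists_perm i : exists j k, perm i j k.
Proof.
destruct i; [exists I1, I2 | exists I0, I2 | exists I0, I1];
  repeat split; discriminate.
Qed.

Lemma h_sum i j k p : perm i j k -> h i p + h j p + h k p = 0.
Proof.
unfold perm; assert (Hs : sqrt 3 <> 0) by (apply Rgt_not_eq, sqrt_lt_R0; lra).
destruct i, j, k; intros (? & ? & ?); try congruence; unfold h; field; exact Hs.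
Qed.

Ltac hsums H :=
  match type of H with
  | perm ?i ?j ?k =>
    repeat match goal with
    | p : point |- _ =>
      lazymatch goal with
      | _ : h i p + h j p + h k p = 0 |- _ => fail
      | _ => pose proof (h_sum i j k p H)
      end
    end
  end.

(** Only positive cones are named: [t] in the negative cone [i] of [v] reads [in_cone i t v]. *)
Definition in_cone (i : idx) (u v : point) : Prop :=
  forall j, j <> i -> h j v < h j u.

Lemma in_cone_iff i j k u v :
  perm i j k -> in_cone i u v <-> h j v < h j u /\ h k v < h k u.
Proof.
intros Hp; split.
- intros Hc; destruct Hp as (? & ? & ?); split; apply Hc; congruence.
- intros [? ?] l Hl; destruct (perm_cover _ _ _ l Hp) as [->|[->| ->]];
    congruence || assumption.
Qed.

Lemma in_cone_ne i u v : in_cone i u v -> u <> v.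
Proof.
destruct (exists_perm i) as (j & k & Hp); rewrite (in_cone_iff i j k) by assumption.
intros [Hj _] ->; lra.
Qed.

Lemma in_cone_inj i i' u v : in_cone i u v -> in_cone i' u v -> i = i'.
Proof.
intros H1 H2; destruct (classic (i = i')) as [|Hn]; [assumption|exfalso].
pose proof (perm_third i i' Hn) as Hp.
rewrite (in_cone_iff _ _ _ _ _ Hp) in H1.
rewrite (in_cone_iff _ _ _ _ _ (perm_swap _ _ _ (perm_rot _ _ _ (perm_rot _ _ _ Hp)))) in H2.
hsums Hp; lra.
Qed.

Lemma in_cone_opp i i' u v : in_cone i u v -> in_cone i' v u -> False.
Proof.
intros H1 H2; destruct (classic (i = i')) as [<-|Hn].
- destruct (exists_perm i) as (j & k & Hp).
  rewrite (in_cone_iff _ _ _ _ _ Hp) in H1; rewrite (in_cone_iff _ _ _ _ _ Hp) in H2; lra.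
- pose proof (perm_third i i' Hn) as (? & ? & ?).
  specialize (H1 (third i i')); specialize (H2 (third i i')).
  assert (h (third i i') v < h (third i i') u) by (apply H1; congruence).
  assert (h (third i i') u < h (third i i') v) by (apply H2; congruence).
  lra.
Qed.

(** With [/ sqrt 3] abstracted to [s], the two radicands differ by a multiple of [1 - 3 * s ^ 2],
    which vanishes. *)
Lemma dist_sqr i j k p q : perm i j k ->
  dist p q = sqrt ((h j p - h j q) ^ 2 + (h j p - h j q) * (h k p - h k q)
                   + (h k p - h k q) ^ 2).
Proof.
intros Hp; unfold dist; f_equal.
assert (Hs : sqrt 3 <> 0) by (apply Rgt_not_eq, sqrt_lt_R0; lra).
assert (Hs2 : sqrt 3 ^ 2 = 3) by (apply pow2_sqrt; lra).
assert (Hi : (/ sqrt 3) ^ 2 = / 3) by (rewrite pow_inv, Hs2; reflexivity).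
destruct Hp as (? & ? & ?).
destruct i, j, k; try congruence; unfold h, Rdiv;
  generalize dependent (/ sqrt 3); intros s Hi; apply Rminus_diag_uniq;
  match goal with |- ?e = 0 =>
    replace e with ((snd p - snd q) ^ 2 * (1 - 3 * s ^ 2)) by ring end;
  rewrite Hi; field.
Qed.

Lemma dist_sym p q : dist p q = dist q p.
Proof. unfold dist; f_equal; ring. Qed.

Lemma dist_ge0 p q : 0 <= dist p q.
Proof. apply sqrt_pos. Qed.

Lemma dist_le i j k p q : perm i j k ->
  dist p q <= Rabs (h j p - h j q) + Rabs (h k p - h k q).
Proof.
intros Hp; rewrite (dist_sqr i j k p q Hp).
set (a := h j p - h j q); set (b := h k p - h k q).
pose proof (Rabs_pos a); pose proof (Rabs_pos b).
rewrite <- (sqrt_pow2 (Rabs a + Rabs b)) by lra.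
apply sqrt_le_1_alt.
replace ((Rabs a + Rabs b) ^ 2) with (Rabs a ^ 2 + Rabs b ^ 2 + 2 * Rabs (a * b))
  by (rewrite Rabs_mult; ring).
rewrite !pow2_abs; pose proof (Rle_abs (a * b)); pose proof (Rabs_pos (a * b)); lra.
Qed.

(** * Induction and minima over a finite point set *)

Lemma finite_ind (P : list point) (f : point -> R) (Q : point -> Prop) :
  (forall x, In x P -> (forall y, In y P -> f y < f x -> Q y) -> Q x) ->
  forall x, In x P -> Q x.
Proof.
intros IH.
(* The number of points with a smaller value of [f] turns a real measure into a natural number. *)
pose (below x := filter (fun y => if Rlt_dec (f y) (f x) then true else false) P).
assert (Hlen : forall x y, In y P -> f y < f x ->
          (length (below y) < length (below x))%nat).
{ intros x y Hy Hyx; unfold below; clear IH below; induction P as [|z P IHP]; [easy|].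
  assert (Hmon : forall l,
    (length (filter (fun z => if Rlt_dec (f z) (f y) then true else false) l)
     <= length (filter (fun z => if Rlt_dec (f z) (f x) then true else false) l))%nat).
  { induction l as [|w l IHl]; simpl; [lia|].
    destruct (Rlt_dec (f w) (f y)), (Rlt_dec (f w) (f x)); simpl; lra || lia. }
  simpl; destruct Hy as [->|Hy].
  - destruct (Rlt_dec (f y) (f y)); [lra|]; destruct (Rlt_dec (f y) (f x)); [|lra].
    simpl; specialize (Hmon P); lia.
  - specialize (IHP Hy).
    destruct (Rlt_dec (f z) (f y)), (Rlt_dec (f z) (f x)); simpl; lra || lia. }
assert (H : forall n x, In x P -> (length (below x) < n)%nat -> Q x).
{ induction n as [|n IHn]; intros x Hx Hn; [lia|].
  apply IH; [assumption|]; intros y Hy Hyx; apply IHn; [assumption|].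
  specialize (Hlen x y Hy Hyx); lia. }
intros x Hx; exact (H (S (length (below x))) x Hx (Nat.lt_succ_diag_r _)).
Qed.

Lemma finite_min (P : list point) (f : point -> R) (Q : point -> Prop) :
  (exists x, In x P /\ Q x) ->
  exists x, In x P /\ Q x /\ forall y, In y P -> Q y -> f x <= f y.
Proof.
intros (x & Hx & HQ); revert HQ; pattern x.
apply (finite_ind P f); [|assumption]; clear x Hx.
intros x Hx IH HQ.
destruct (classic (exists y, In y P /\ Q y /\ f y < f x)) as [(y & Hy & HQy & Hlt)|Hno].
- destruct (IH y Hy Hlt HQy) as (z & Hz); exists z; exact Hz.
- exists x; repeat split; [assumption..|]; intros y Hy HQy.
  apply Rnot_lt_le; intros Hlt; apply Hno; eauto.
Qed.

(** * Parents, children and siblings in the half-theta-6-graph *)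

Definition parent (P : list point) (i : idx) (x u : point) : Prop :=
  In x P /\ In u P /\ in_cone i x u /\
  forall y, In y P -> in_cone i x y -> h i u <= h i y.

(** Children have smaller [h i] than their parent, so the closest one maximises [h i]. *)
Definition closest_child (P : list point) (i : idx) (u c : point) : Prop :=
  parent P i c u /\ forall x, parent P i x u -> h i x <= h i c.

Definition first_child (P : list point) (i k : idx) (u c : point) : Prop :=
  parent P i c u /\ forall x, parent P i x u -> h k c <= h k x.

Definition next_sibling (P : list point) (i k : idx) (x y : point) : Prop :=
  exists u, parent P i x u /\ parent P i y u /\ h k x < h k y /\
    forall z, parent P i z u -> h k x < h k z -> h k y <= h k z.

(** General position in these coordinates: the level lines of the [h i] are the parallels to the
    cone boundaries. *)
Definition separated (P : list point) : Prop :=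
  forall p q, In p P -> In q P -> p <> q -> forall i, h i p <> h i q.

Lemma parent_exists P i x y : In x P -> In y P -> in_cone i x y ->
  exists u, parent P i x u /\ h i u <= h i y.
Proof.
intros Hx Hy Hc.
destruct (finite_min P (h i) (in_cone i x)) as (u & Hu & Hcu & Hm); [eauto|].
exists u; unfold parent; auto.
Qed.

Lemma finite_min_child P i u (f : point -> R) (Q : point -> Prop) :
  (exists x, parent P i x u /\ Q x) ->
  exists x, parent P i x u /\ Q x /\ forall y, parent P i y u -> Q y -> f x <= f y.
Proof.
intros (x & Hx & HQ).
destruct (finite_min P f (fun x => parent P i x u /\ Q x)) as (c & Hc & [Hcu HQc] & Hm).
- exists x; split; [apply Hx|auto].
- exists c; do 2 (split; [assumption|]); intros y Hy HQy; apply Hm; [apply Hy|auto].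
Qed.

Section Separated.
Context (P : list point) (HP : separated P).

Lemma separated_lt_or p q i : In p P -> In q P -> p <> q -> h i p < h i q \/ h i q < h i p.
Proof. intros Hp Hq Hn; specialize (HP p q Hp Hq Hn i); lra. Qed.

Lemma h_inj i p q : In p P -> In q P -> h i p = h i q -> p = q.
Proof.
intros Hp Hq He; destruct (classic (p = q)) as [|Hn]; [assumption|].
exfalso; exact (HP p q Hp Hq Hn i He).
Qed.

Lemma parent_unique i x u v : parent P i x u -> parent P i x v -> u = v.
Proof.
intros (Hx & Hu & Hxu & Hmu) (_ & Hv & Hxv & Hmv).
apply (h_inj i); try assumption.
specialize (Hmu v Hv Hxv); specialize (Hmv u Hu Hxu); lra.
Qed.

Lemma parent_empty i j k x u y : perm i j k -> parent P i x u -> In y P ->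
  h j y < h j x -> h k y < h k x -> h i u <= h i y.
Proof.
intros Hp (_ & _ & _ & Hm) Hy Hj Hk; apply Hm; [assumption|].
rewrite (in_cone_iff i j k); auto.
Qed.

(** If [a] were smaller in both coordinates, it would lie in cone [i] of [b] below [u], and [u]
    would not be the parent of [b]. *)
Lemma siblings_order i j k a b u : perm i j k ->
  parent P i a u -> parent P i b u -> h k a < h k b -> h j b < h j a.
Proof.
intros Hp Ha Hb Hk.
destruct (separated_lt_or a b j) as [Hj|Hj]; [apply Ha|apply Hb|intros ->; lra| |assumption].
pose proof (parent_empty i j k b u a Hp Hb (proj1 Ha) Hj Hk).
destruct Ha as (_ & _ & Ha & _); rewrite (in_cone_iff _ _ _ _ _ Hp) in Ha.
hsums Hp; lra.
Qed.

(** Following cone-[i] edges from [x] towards [v] can only leave the box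
    through the two excluded regions, hence ends with an edge into [v]. *)
Lemma climb i j k v x beta gamma : perm i j k -> In v P -> In x P ->
  h j v < h j x <= beta -> h k v < h k x <= gamma ->
  (forall q, In q P -> in_cone k v q -> h k q < gamma -> False) ->
  (forall q, In q P -> in_cone j v q -> h j q < beta -> False) ->
  exists c, parent P i c v /\ h j c <= beta /\ h k c <= gamma.
Proof.
intros Hp Hv Hx Hj Hk Ek Ej.
(* A highest point of the box replaces the iteration: its parent is [v], lies in an excluded region,
   or is a higher point of the box. *)
destruct (finite_min P (fun p => - h i p)
  (fun p => h j v < h j p <= beta /\ h k v < h k p <= gamma))
  as (c & Hc & [Hcj Hck] & Hm); [eauto|].
exists c; split; [|lra].
destruct (parent_exists P i c v Hc Hv) as (q & Hq & Hqv).
{ rewrite (in_cone_iff i j k); lra || assumption. }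
destruct (classic (q = v)) as [->|Hn]; [assumption|exfalso].
destruct Hq as (_ & HqP & Hcq & _); rewrite (in_cone_iff _ _ _ _ _ Hp) in Hcq.
assert (Hi : h i q < h i v) by (destruct (separated_lt_or q v i); auto; lra).
destruct (separated_lt_or q v j HqP Hv Hn) as [Hqj|Hqj].
{ apply (Ek q HqP); [|lra].
  apply (in_cone_iff _ _ _ _ _ (perm_rot _ _ _ (perm_rot _ _ _ Hp))); auto. }
destruct (separated_lt_or q v k HqP Hv Hn) as [Hqk|Hqk].
{ apply (Ej q HqP); [|lra]; apply (in_cone_iff _ _ _ _ _ (perm_rot _ _ _ Hp)); auto. }
specialize (Hm q HqP); hsums Hp; lra.
Qed.

(** A climb from [x] would end at a child of [u] which, children being monotone, lies strictly
    between the consecutive [a] and [b]. *)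
Lemma between_siblings_empty i j k a b u x : perm i j k ->
  parent P i a u -> parent P i b u ->
  (forall z, parent P i z u -> h k a < h k z -> h k b <= h k z) ->
  In x P -> h j b < h j x < h j a -> h k a < h k x < h k b -> False.
Proof.
intros Hp Ha Hb Hab Hx Hj Hk.
assert (Ha' := Ha); assert (Hb' := Hb).
destruct Ha' as (HaP & Hu & Ha' & _), Hb' as (HbP & _ & Hb' & _).
rewrite (in_cone_iff _ _ _ _ _ Hp) in Ha'; rewrite (in_cone_iff _ _ _ _ _ Hp) in Hb'.
destruct (climb i j k u x (h j x) (h k x) Hp Hu Hx) as (c & Hc & Hcj & Hck); try lra.
- intros q Hq Hc Hqk.
  rewrite (in_cone_iff _ _ _ _ _ (perm_rot _ _ _ (perm_rot _ _ _ Hp))) in Hc.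
  pose proof (parent_empty i j k b u q Hp Hb Hq); lra.
- intros q Hq Hc Hqk; rewrite (in_cone_iff _ _ _ _ _ (perm_rot _ _ _ Hp)) in Hc.
  pose proof (parent_empty i j k a u q Hp Ha Hq); lra.
- assert (Hac : h k a < h k c).
  { destruct (Rlt_dec (h k c) (h k a)) as [Hca|].
    - pose proof (siblings_order i j k c a u Hp Hc Ha Hca); lra.
    - destruct (separated_lt_or a c k HaP (proj1 Hc)); [intros <-; lra|lra|lra]. }
  specialize (Hab c Hc Hac); lra.
Qed.

(** The triangle formed by [a], [b] and their common parent contains no point. *)
Lemma next_sibling_parent i j k a b : perm i j k -> next_sibling P i k a b ->
  parent P j b a \/ parent P k a b.
Proof.
intros Hp (u & Ha & Hb & Hk & Hab).
pose proof (siblings_order i j k a b u Hp Ha Hb Hk) as Hj.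
assert (Ha' := Ha); assert (Hb' := Hb).
destruct Ha' as (HaP & Hu & Ha' & _), Hb' as (HbP & _ & Hb' & _).
rewrite (in_cone_iff _ _ _ _ _ Hp) in Ha'; rewrite (in_cone_iff _ _ _ _ _ Hp) in Hb'.
(* A third point here would lie in the empty triangle of the edge from [b] to [u], in that of the
   edge from [a] to [u], or between the siblings. *)
assert (Hne : forall x, In x P -> h i x < h i u ->
   h j x < h j a -> h k x < h k b -> x = a \/ x = b).
{ intros x Hx Hi Hxj Hxk; apply NNPP; intros Hn; apply not_or_and in Hn as [Hna Hnb].
  destruct (separated_lt_or x b j Hx HbP Hnb).
  { pose proof (parent_empty i j k b u x Hp Hb Hx); lra. }
  destruct (separated_lt_or x a k Hx HaP Hna).
  { pose proof (parent_empty i j k a u x Hp Ha Hx); lra. }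
  apply (between_siblings_empty i j k a b u x); auto. }
destruct (separated_lt_or a b i) as [Hi|Hi]; try assumption; [intros <-; lra| |].
- left; repeat split; try assumption.
  + apply (in_cone_iff _ _ _ _ _ (perm_rot _ _ _ Hp)); auto.
  + intros y Hy Hc; rewrite (in_cone_iff _ _ _ _ _ (perm_rot _ _ _ Hp)) in Hc.
    destruct (Rle_dec (h j a) (h j y)); [assumption|].
    destruct (Hne y Hy) as [->| ->]; hsums Hp; lra.
- right; repeat split; try assumption.
  + apply (in_cone_iff _ _ _ _ _ (perm_rot _ _ _ (perm_rot _ _ _ Hp))); auto.
  + intros y Hy Hc.
    rewrite (in_cone_iff _ _ _ _ _ (perm_rot _ _ _ (perm_rot _ _ _ Hp))) in Hc.
    destruct (Rle_dec (h k b) (h k y)); [assumption|].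
    destruct (Hne y Hy) as [->| ->]; hsums Hp; lra.
Qed.

(** This is why the canonical paths belong to [G12]. *)
Lemma next_sibling_extreme i j k a b x : perm i j k -> next_sibling P i k a b ->
  parent P j b a -> parent P j x a -> h i x <= h i b.
Proof.
intros Hp (u & Ha & Hb & Hk & Hab) Hba Hxa.
pose proof (perm_rot _ _ _ Hp) as Hp'.
apply Rnot_lt_le; intros Hi.
pose proof (siblings_order j k i b x a Hp' Hba Hxa Hi) as Hxk.
assert (Ha' := Ha); assert (Hb' := Hb); assert (Hxa' := Hxa).
destruct Ha' as (HaP & Hu & Ha' & _), Hb' as (HbP & _ & Hb' & _).
destruct Hxa' as (HxP & _ & Hxa' & _).
rewrite (in_cone_iff _ _ _ _ _ Hp) in Ha'; rewrite (in_cone_iff _ _ _ _ _ Hp) in Hb'.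
rewrite (in_cone_iff _ _ _ _ _ Hp') in Hxa'.
assert (Hxu : h i x < h i u).
{ destruct (separated_lt_or x u i) as [|Hux]; [assumption..|intros ->; lra|assumption|].
  pose proof (parent_empty j k i x a u Hp' Hxa Hu); lra. }
destruct (Rlt_dec (h j x) (h j b)) as [Hxb|Hxb].
{ pose proof (parent_empty i j k b u x Hp Hb HxP); lra. }
destruct (separated_lt_or x b j HxP HbP); [intros ->; lra|lra|].
apply (between_siblings_empty i j k a b u x); auto; hsums Hp; lra.
Qed.

End Separated.

(** * The routing algorithm *)

Definition decide (Q : Prop) : {Q} + {~ Q} := excluded_middle_informative Q.

(** The default matters: [known] passes the vertex itself, so a missing point fails the strict
    coordinate comparisons of the algorithm. *)
Definition pick (Q : point -> Prop) (d : point) : point :=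
  if decide (exists x, Q x) then epsilon (inhabits d) Q else d.

Lemma pick_spec Q d : (exists x, Q x) -> Q (pick Q d).
Proof.
intros He; unfold pick; destruct (decide _); [|contradiction].
apply epsilon_spec; assumption.
Qed.

Lemma pick_cases Q d : pick Q d = d \/ Q (pick Q d).
Proof.
destruct (classic (exists x, Q x)) as [He|Hn]; [right; apply pick_spec, He|left].
unfold pick; destruct (decide _); [contradiction|reflexivity].
Qed.

Definition which (Q : idx -> Prop) : option idx :=
  if decide (Q I0) then Some I0 else
  if decide (Q I1) then Some I1 else
  if decide (Q I2) then Some I2 else None.

Lemma which_some Q i : which Q = Some i -> Q i.
Proof.
unfold which; destruct (decide (Q I0)), (decide (Q I1)), (decide (Q I2));
  intros [= <-] || discriminate; assumption.
Qed.

Lemma which_none Q : which Q = None -> forall i, ~ Q i.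
Proof.
unfold which; destruct (decide (Q I0)), (decide (Q I1)), (decide (Q I2));
  try discriminate; intros _ []; assumption.
Qed.

Lemma which_eq Q i : Q i -> (forall i', Q i' -> i' = i) -> which Q = Some i.
Proof.
intros Hi Hu; destruct (which Q) as [i'|] eqn:E.
- rewrite (Hu i'); [reflexivity|]; apply which_some, E.
- exfalso; exact (which_none Q E i Hi).
Qed.

(** The points a vertex knows: its parents, the next vertex on its way to a
    parent along the canonical path, its closest and first children and its
    next siblings. A missing point is replaced by the vertex itself. *)
Inductive slot :=
| Parent (i : idx) | Toward (i : idx) | Closest (i : idx)
| First (i k : idx) | Sibling (i k : idx).

(** [y] follows [x] on the path that simulates the edge from [x] to its
    parent. *)
Definition toward (P : list point) (i : idx) (x y : point) : Prop :=
  exists q, parent P i x q /\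
    (closest_child P i q x /\ y = q \/
     exists k c, k <> i /\ closest_child P i q c /\ h k x < h k c /\
       next_sibling P i k x y).

Definition known (P : list point) (s : point) (sl : slot) : point :=
  match sl with
  | Parent i => pick (parent P i s) s
  | Toward i => pick (toward P i s) s
  | Closest i => pick (closest_child P i s) s
  | First i k => pick (first_child P i k s) s
  | Sibling i k => pick (next_sibling P i k s) s
  end.

(** [Up q]: following the canonical path of [q] towards its closest child, then
    moving to [q]. [Down q k]: on the canonical path of [q], looking for its
    last vertex in direction [k] that does not lie beyond the destination. *)
Inductive mode := Decide | Up (q : point) | Down (q : point) (k : idx).

(** The cone is recovered from the coordinates of [s] and [q], so the memory carries only [q]. *)
Definition go_up (d : slot -> point) (s q : point) : point * mode :=
  match which (fun i => in_cone i s q) with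
  | Some i => let y := d (Toward i) in (y, if decide (y = q) then Decide else Up q)
  | None => (s, Decide)
  end.

(** Some vertex of the triangle spanned by [t] and [s] lies in the positive
    cone [k] of [s]. *)
Definition occupied (d : slot -> point) (s t : point) (k : idx) : Prop :=
  h k s < h k (d (Parent k)) < h k t.

Definition gap (s t : point) (k : idx) : R := h k t - h k s.

(** The first child has the least [h k], so it lies beyond [t] exactly when all children do. *)
Definition hug (d : slot -> point) (s t : point) (i k : idx) : point * mode :=
  if decide (h k s < h k (d (First i k)) <= h k t)
  then (d (Closest i), Down s k)
  else go_up d s (d (Parent (third i k))).

Definition choose (d : slot -> point) (s t : point) : point * mode :=
  match which (fun i => in_cone i s t), which (fun i => in_cone i t s) with
  | Some i, _ => go_up d s (d (Parent i))
  | None, Some i =>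
    (* If both sides are empty, [k] is the one with the larger gap, so that the cost involves the
       smaller gap. *)
    match which (fun k => k <> i /\ ~ occupied d s t k /\
                   (~ occupied d s t (third i k) -> gap s t (third i k) <= gap s t k)) with
    | Some k => hug d s t i k
    | None =>
      if decide (h i (d (Closest i)) < h i s) then (d (Closest i), Decide)
      else match which (fun j => j <> i /\ gap s t j <= gap s t (third i j)) with
           | Some j => go_up d s (d (Parent j))
           | None => (s, Decide)
           end
    end
  | None, None => (s, Decide)
  end.

(** When the search ends, [choose] is called at once: every step of the run has to follow an
    edge. *)
Definition go_down (d : slot -> point) (s t q : point) (k : idx) : point * mode :=
  match which (fun i => in_cone i s q) with
  | Some i =>
    if decide (h k t < h k s) then (d (Sibling i (third i k)), Down q k)
    else if decide (h k s < h k (d (Sibling i k)) <= h k t)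
    then (d (Sibling i k), Down q k)
    else choose d s t
  | None => (s, Decide)
  end.

Definition move (d : slot -> point) (s t : point) (m : mode) : point * mode :=
  match m with
  | Decide => choose d s t
  | Up q => go_up d s q
  | Down q k => go_down d s t q k
  end.

(** * Walks and the cost of simulating one edge *)

Definition mode_in (P : list point) (m : mode) : Prop :=
  match m with Decide => True | Up q | Down q _ => In q P end.

(** The only edges that walks may use; all of them belong to both graphs. *)
Definition link (P : list point) (a b : point) : Prop :=
  exists i, closest_child P i a b \/ closest_child P i b a \/
    exists k, k <> i /\ (next_sibling P i k a b \/ next_sibling P i k b a).

(** [L] is a budget for the remaining length. Being inductive, the predicate also contains
    termination. *)
Inductive reach (P : list point) (t : point) : point -> mode -> R -> Prop :=
| reach_stop m L : 0 <= L -> reach P t t m L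
| reach_move s m s' m' L : s <> t -> move (known P s) s t m = (s', m') ->
    link P s s' -> mode_in P m' -> reach P t s' m' (L - dist s s') ->
    reach P t s m L.

Lemma reach_ge0 P t s m L : reach P t s m L -> 0 <= L.
Proof.
induction 1 as [|s m s' m' L _ _ _ _ _ IH]; [assumption|].
pose proof (dist_ge0 s s'); lra.
Qed.

Lemma reach_le P t s m L L' : reach P t s m L -> L <= L' -> reach P t s m L'.
Proof.
intros H; revert L'; induction H as [m L HL|s m s' m' L Hn Hm Hl Hin _ IH]; intros L' HLL.
- apply reach_stop; lra.
- apply (reach_move _ _ _ _ s' m'); try assumption; apply IH; lra.
Qed.

(** Modes matter only through the next move. This covers a search that falls through to [choose],
    and a decision that starts an upward walk. *)
Lemma reach_same_move P t s m m' L :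
  move (known P s) s t m' = move (known P s) s t m ->
  reach P t s m L -> reach P t s m' L.
Proof.
intros Hm H; destruct H as [m L HL|s m s1 m1 L Hn H1 Hl Hin H].
- apply reach_stop; assumption.
- apply (reach_move _ _ _ _ s1 m1); try assumption; congruence.
Qed.

(** An upper bound on the distance that telescopes along canonical paths, since these are monotone
    in both coordinates. *)
Definition span (j k : idx) (a b : point) : R :=
  Rabs (h j a - h j b) + Rabs (h k a - h k b).

Section Walks.
Context (P : list point) (HP : separated P).

Lemma which_cone i s q : in_cone i s q -> which (fun i => in_cone i s q) = Some i.
Proof. intros H; apply which_eq; [assumption|]; intros; eapply in_cone_inj; eassumption. Qed.

Lemma which_cone_opp i s q : in_cone i s q -> which (fun i => in_cone i q s) = None.
Proof.
intros H; destruct (which _) as [i'|] eqn:E; [|reflexivity].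
exfalso; exact (in_cone_opp _ _ _ _ H (which_some _ _ E)).
Qed.

Lemma next_sibling_exists i k x b u : parent P i x u -> parent P i b u ->
  h k x < h k b -> exists y, next_sibling P i k x y.
Proof.
intros Hx Hb Hk.
destruct (finite_min_child P i u (h k) (fun y => h k x < h k y)) as (y & Hy & Hxy & Hm);
  [eauto|].
exists y, u; auto.
Qed.

Lemma next_sibling_span i j k x b u y : perm i j k ->
  parent P i x u -> parent P i b u -> h k x < h k b -> next_sibling P i k x y ->
  parent P i y u /\ h k x < h k y <= h k b /\
  span j k y b < span j k x b /\ dist x y <= span j k x b - span j k y b.
Proof.
intros Hp Hx Hb Hk (u' & Hx' & Hy & Hxy & Hm).
rewrite <- (parent_unique P HP i x u u' Hx Hx') in *.
assert (Hyb : h k y <= h k b) by auto.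
assert (Hj : h j y < h j x) by (apply (siblings_order P HP i j k x y u); assumption).
assert (Hj' : h j b <= h j y).
{ destruct (Rle_lt_or_eq_dec _ _ Hyb) as [Hlt|Heq].
  - apply Rlt_le, (siblings_order P HP i j k y b u); assumption.
  - rewrite (h_inj P HP k y b); [lra|apply Hy|apply Hb|assumption]. }
pose proof (dist_le i j k x y Hp) as Hd; rewrite Rabs_pos_eq, Rabs_left1 in Hd by lra.
unfold span; rewrite (Rabs_pos_eq (h j y - h j b)), (Rabs_left1 (h k y - h k b)),
  (Rabs_pos_eq (h j x - h j b)), (Rabs_left1 (h k x - h k b)) by lra.
split; [assumption|repeat split; lra].
Qed.

Lemma closest_child_exists i x u : parent P i x u -> exists c, closest_child P i u c.
Proof.
intros Hx; destruct (finite_min_child P i u (fun c => - h i c) (fun _ => True))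
  as (c & Hc & _ & Hm); [eauto|].
exists c; split; [assumption|]; intros y Hy; specialize (Hm y Hy I); lra.
Qed.

(** Source of the factor 3: the two coordinate differences of [x] and [c] and the edge from [u] to
    [c] are each at most the side [h i u - h i x], because [c] is closest. *)
Lemma closest_child_span i j k u c x : perm i j k ->
  closest_child P i u c -> parent P i x u ->
  dist u c <= h i u - h i c /\ span j k x c + dist u c <= 3 * (h i u - h i x).
Proof.
intros Hp [Hc Hm] Hx; specialize (Hm x Hx).
pose proof (dist_le i j k u c Hp) as Hd.
assert (Hc' := Hc); destruct Hc' as (HcP & _ & Hc' & _).
assert (Hx' := Hx); destruct Hx' as (HxP & _ & Hx' & _).
rewrite (in_cone_iff _ _ _ _ _ Hp) in Hc'; rewrite (in_cone_iff _ _ _ _ _ Hp) in Hx'.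
rewrite !Rabs_left1 in Hd by lra; unfold span.
split; [hsums Hp; lra|].
destruct (classic (x = c)) as [->|Hn].
{ rewrite !Rminus_diag, Rabs_R0; hsums Hp; lra. }
destruct (separated_lt_or P HP x c k) as [Hk|Hk]; try assumption.
- pose proof (siblings_order P HP i j k x c u Hp Hx Hc Hk).
  rewrite Rabs_pos_eq, Rabs_left1 by lra; hsums Hp; lra.
- pose proof (siblings_order P HP i j k c x u Hp Hc Hx Hk).
  rewrite Rabs_left1, Rabs_pos_eq by lra; hsums Hp; lra.
Qed.

Lemma span_ge0 j k a b : 0 <= span j k a b.
Proof.
unfold span; pose proof (Rabs_pos (h j a - h j b)).
pose proof (Rabs_pos (h k a - h k b)); lra.
Qed.

Lemma span_comm j k a b : span j k a b = span k j a b.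
Proof. unfold span; ring. Qed.

Context (t : point).

(** Induction on the span to [c]: each step pays for its length by the decrease of the span, and the
    last edge costs [dist q c]. *)
Lemma go_up_reach i q c L j k : perm i j k -> closest_child P i q c -> reach P t q Decide L ->
  forall x, parent P i x q -> reach P t x (Up q) (L + span j k x c + dist q c).
Proof.
intros Hp Hc Hq x Hx; assert (HxP := proj1 Hx); revert Hx; pattern x.
apply (finite_ind P (fun x => span j k x c)); [clear x HxP|assumption].
intros x HxP IH Hx.
destruct (classic (x = t)) as [->|Hn].
{ apply reach_stop; pose proof (reach_ge0 _ _ _ _ _ Hq);
  pose proof (span_ge0 j k t c); pose proof (dist_ge0 q c); lra. }
assert (Hex : exists y, toward P i x y).
{ destruct (classic (x = c)) as [->|Hxc]; [exists q, q; auto|].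
  destruct (separated_lt_or P HP x c k HxP (proj1 (proj1 Hc)) Hxc) as [Hk|Hk].
  - destruct (next_sibling_exists i k x c q Hx (proj1 Hc) Hk) as (y & Hy).
    exists y, q; split; [assumption|right]; exists k, c; repeat split; try apply Hc; try assumption.
    destruct Hp as (? & ? & ?); congruence.
  - pose proof (siblings_order P HP i j k c x q Hp (proj1 Hc) Hx Hk) as Hj.
    destruct (next_sibling_exists i j x c q Hx (proj1 Hc) Hj) as (y & Hy).
    exists y, q; split; [assumption|right]; exists j, c; repeat split; try apply Hc; try assumption.
    destruct Hp as (? & ? & ?); congruence. }
apply (pick_spec _ x) in Hex; change (pick _ _) with (known P x (Toward i)) in Hex.
assert (Hmove : move (known P x) x t (Up q) =
  (known P x (Toward i),
   if decide (known P x (Toward i) = q) then Decide else Up q)).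
{ simpl; unfold go_up; rewrite (which_cone i); [reflexivity|apply Hx]. }
revert Hex Hmove; generalize (known P x (Toward i)); intros y (q' & Hx' & Hy) Hmove.
rewrite <- (parent_unique P HP i x q q' Hx Hx') in *; clear q' Hx'.
assert (HqP : In q P) by apply Hx.
destruct Hy as [[Hxq ->]|(k' & c' & Hk' & Hc' & Hlt & Hy)].
- destruct (decide (q = q)) as [_|]; [|congruence].
  apply (reach_move _ _ _ _ q Decide); try assumption; try exact I.
  + exists i; auto.
  + apply (reach_le _ _ _ _ L); [assumption|].
    assert (x = c) as ->.
    { apply (h_inj P HP i); [assumption|apply Hc|].
      pose proof (proj2 Hxq c (proj1 Hc)); pose proof (proj2 Hc x Hx); lra. }
    pose proof (span_ge0 j k c c); rewrite (dist_sym c q); lra.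
- assert (c' = c) as ->.
  { apply (h_inj P HP i); [apply Hc'|apply Hc|].
    pose proof (proj2 Hc' c (proj1 Hc)); pose proof (proj2 Hc c' (proj1 Hc')); lra. }
  assert (Hstep : parent P i y q /\ span j k y c < span j k x c /\
            dist x y <= span j k x c - span j k y c).
  { destruct (perm_cover _ _ _ k' Hp) as [->|[->| ->]]; [congruence| |].
    - rewrite !(span_comm j k).
      destruct (next_sibling_span i k j x c q y (perm_swap _ _ _ Hp) Hx (proj1 Hc) Hlt Hy);
        intuition.
    - destruct (next_sibling_span i j k x c q y Hp Hx (proj1 Hc) Hlt Hy); intuition. }
  destruct Hstep as (Hyq & Hs & Hd).
  assert (Hyne : y <> q) by (intros ->; apply (in_cone_ne i q q); [apply Hyq|reflexivity]).
  destruct (decide (y = q)) as [|_]; [contradiction|].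
  apply (reach_move _ _ _ _ y (Up q)); try assumption.
  + exists i; right; right; exists k'; auto.
  + apply (reach_le _ _ _ _ (L + span j k y c + dist q c)); [|lra].
    apply IH; [apply Hyq|assumption|assumption].
Qed.

Lemma simulate_up i x q L : parent P i x q -> reach P t q Decide L ->
  reach P t x (Up q) (L + 3 * (h i q - h i x)).
Proof.
intros Hx Hq; destruct (exists_perm i) as (j & k & Hp).
destruct (closest_child_exists i x q Hx) as (c & Hc).
apply (reach_le _ _ _ _ (L + span j k x c + dist q c)).
- apply (go_up_reach i q c L j k); assumption.
- pose proof (proj2 (closest_child_span i j k q c x Hp Hc Hx)); lra.
Qed.

(** [c] is the last child not beyond [t]. Children beyond [t] walk back in direction [j], the others
    forward in direction [k], and neither walk passes [c]. *)
Lemma go_down_reach i j k u c L : perm i j k -> parent P i c u -> h k c <= h k t ->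
  (forall z, parent P i z u -> h k z <= h k t -> h k z <= h k c) ->
  reach P t c Decide L ->
  forall x, parent P i x u -> reach P t x (Down u k) (L + span j k x c).
Proof.
intros Hp Hc Hct Hlast Hr x Hx; assert (HxP := proj1 Hx); revert Hx; pattern x.
apply (finite_ind P (fun x => span j k x c)); [clear x HxP|assumption].
intros x HxP IH Hx; pose proof (reach_ge0 _ _ _ _ _ Hr); pose proof (span_ge0 j k x c).
destruct (classic (x = t)) as [->|Hn]; [apply reach_stop; lra|].
assert (Hmove : move (known P x) x t (Down u k) =
    if decide (h k t < h k x) then (known P x (Sibling i j), Down u k)
    else if decide (h k x < h k (known P x (Sibling i k)) <= h k t)
    then (known P x (Sibling i k), Down u k)
    else choose (known P x) x t).
{ simpl; unfold go_down; rewrite (which_cone i) by apply Hx.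
  rewrite (third_perm i j k Hp); reflexivity. }
assert (Hki : k <> i /\ j <> i) by (destruct Hp as (? & ? & ?); split; congruence).
assert (HuP : In u P) by apply Hx.
destruct (decide (h k t < h k x)) as [Hlt|Hge].
{ assert (Hj : h j x < h j c) by (apply (siblings_order P HP i j k c x u); assumption || lra).
  pose proof (pick_spec _ x (next_sibling_exists i j x c u Hx Hc Hj)) as Hy.
  change (pick _ _) with (known P x (Sibling i j)) in Hy.
  destruct (next_sibling_span i k j x c u _ (perm_swap _ _ _ Hp) Hx Hc Hj Hy)
    as (Hyu & _ & Hs & Hd).
  rewrite !(span_comm k j) in Hs, Hd.
  apply (reach_move _ _ _ _ _ _ _ Hn Hmove); [|assumption|].
  - exists i; right; right; exists j; intuition.
  - eapply reach_le; [apply IH; [apply Hyu|exact Hs|exact Hyu]|lra]. }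
(* At [c] no next sibling is within reach of [t], so the move is that of [Decide]. *)
destruct (classic (x = c)) as [->|Hxc].
{ apply (reach_le _ _ _ _ L); [|lra].
  apply (reach_same_move _ _ _ Decide); [|assumption]; rewrite Hmove; simpl.
  destruct (decide _) as [[Hk1 Hk2]|]; [exfalso|reflexivity].
  destruct (pick_cases (next_sibling P i k c) c) as [He|He];
    change (pick _ _) with (known P c (Sibling i k)) in He.
  - rewrite He in Hk1; lra.
  - destruct He as (u' & Hc' & Hy & _).
    rewrite <- (parent_unique P HP i c u u' Hc Hc') in Hy.
    specialize (Hlast _ Hy Hk2); lra. }
assert (Hk : h k x < h k c).
{ specialize (Hlast x Hx).
  destruct (separated_lt_or P HP x c k HxP (proj1 Hc) Hxc); lra. }
pose proof (pick_spec _ x (next_sibling_exists i k x c u Hx Hc Hk)) as Hy.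
change (pick _ _) with (known P x (Sibling i k)) in Hy.
destruct (next_sibling_span i j k x c u _ Hp Hx Hc Hk Hy) as (Hyu & Hyk & Hs & Hd).
destruct (decide _) as [_|Hno]; [|lra].
apply (reach_move _ _ _ _ _ _ _ Hn Hmove); [|assumption|].
- exists i; right; right; exists k; intuition.
- eapply reach_le; [apply IH; [apply Hyu|exact Hs|exact Hyu]|lra].
Qed.

End Walks.

(** * Routing costs in negative and positive cones *)

Definition clear (P : list point) (t v : point) (k : idx) : Prop :=
  forall q, In q P -> in_cone k v q -> h k q < h k t -> False.

Section Routing.
Context (P : list point) (HP : separated P) (t : point) (Ht : In t P).

(** The parent minimises [h k] over the cone, so inspecting it alone decides emptiness. *)
Lemma not_occupied v k : In v P -> ~ occupied (known P v) v t k <-> clear P t v k.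
Proof.
intros Hv; unfold occupied; split.
- intros Hno q Hq Hc Hqt; apply Hno.
  destruct (parent_exists P k v q Hv Hq Hc) as (u & Hu & Huq).
  assert (Hk : parent P k v (known P v (Parent k))) by (apply (pick_spec (parent P _ v)); eauto).
  rewrite (parent_unique P HP k v _ _ Hk Hu).
  destruct (exists_perm k) as (i & j & Hp).
  destruct Hu as (_ & _ & Hc' & _); rewrite (in_cone_iff _ _ _ _ _ Hp) in Hc'.
  hsums Hp; lra.
- intros Hcl [H1 H2].
  destruct (pick_cases (parent P k v) v) as [He|Hu].
  + change (pick _ _) with (known P v (Parent k)) in He; rewrite He in H1; lra.
  + apply (Hcl (known P v (Parent k))); [apply Hu|apply Hu|assumption].
Qed.

(** The empty triangle of the edge from [c] to [v] covers the part in cone [j]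
    of [v] of the triangle of [t] and [v]. *)
Lemma clear_of_child i j k c v : perm i j k -> in_cone i t v -> parent P i c v ->
  h j t < h j c -> clear P t v j.
Proof.
intros Hp Htv Hc Hj q Hq Hqv Hqt.
rewrite (in_cone_iff _ _ _ _ _ Hp) in Htv.
rewrite (in_cone_iff _ _ _ _ _ (perm_rot _ _ _ Hp)) in Hqv.
assert (Hc' := Hc); destruct Hc' as (_ & _ & Hc' & _).
rewrite (in_cone_iff _ _ _ _ _ Hp) in Hc'.
pose proof (parent_empty P i j k c v q Hp Hc Hq); lra.
Qed.

Lemma child_inside i j k v : perm i j k -> In v P -> in_cone i t v ->
  clear P t v j -> clear P t v k ->
  exists c, parent P i c v /\ h j c <= h j t /\ h k c <= h k t.
Proof.
intros Hp Hv Htv Hj Hk; rewrite (in_cone_iff _ _ _ _ _ Hp) in Htv.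
apply (climb P HP i j k v t); auto; lra.
Qed.

Lemma inside_cone i j k c : perm i j k -> In c P -> h j c <= h j t -> h k c <= h k t ->
  c = t \/ in_cone i t c.
Proof.
intros Hp Hc Hj Hk; destruct (classic (c = t)) as [|Hn]; [left; assumption|right].
apply (in_cone_iff _ _ _ _ _ Hp).
destruct (separated_lt_or P HP c t j), (separated_lt_or P HP c t k); auto; lra.
Qed.

(** If either of the last two properties failed, a climb from [t] or from the offending point would
    give a later child not beyond [t], unless the offending point already contradicts
    [clear P t v k]. *)
Lemma last_child i j k v c1 : perm i j k -> In v P -> in_cone i t v -> clear P t v k ->
  parent P i c1 v -> h k c1 <= h k t ->
  exists c, parent P i c v /\ h k c <= h k t /\
    (forall z, parent P i z v -> h k z <= h k t -> h k z <= h k c) /\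
    h j c <= h j t /\ clear P t c k.
Proof.
intros Hp Hv Htv Hclear Hc1 Hc1t.
destruct (finite_min_child P i v (fun c => - h k c) (fun c => h k c <= h k t))
  as (c & Hc & Hct & Hm); [eauto|].
assert (Hlast : forall z, parent P i z v -> h k z <= h k t -> h k z <= h k c).
{ intros z Hz Hzt; specialize (Hm z Hz Hzt); lra. }
clear Hm; exists c; split; [assumption|]; split; [assumption|]; split; [assumption|].
assert (Hc' := Hc); destruct Hc' as (HcP & _ & Hc' & _).
rewrite (in_cone_iff _ _ _ _ _ Hp) in Hc'.
split.
- apply Rnot_lt_le; intros Hj.
  pose proof (clear_of_child i j k c v Hp Htv Hc Hj) as Hclearj.
  destruct (child_inside i j k v Hp Hv Htv Hclearj Hclear) as (x & Hx & Hxj & Hxk).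
  specialize (Hlast x Hx Hxk).
  destruct (Rle_lt_or_eq_dec _ _ Hlast) as [Hlt|Heq].
  + pose proof (siblings_order P HP i j k x c v Hp Hx Hc Hlt); lra.
  + rewrite (h_inj P HP k x c (proj1 Hx) HcP Heq) in Hxj; lra.
- intros q Hq Hqc Hqt.
  rewrite (in_cone_iff _ _ _ _ _ (perm_rot _ _ _ (perm_rot _ _ _ Hp))) in Hqc.
  assert (Hqv : q <> v) by (intros ->; hsums Hp; lra).
  destruct (separated_lt_or P HP q v j Hq Hv Hqv) as [Hqj|Hqj].
  { apply (Hclear q Hq); [|assumption].
    apply (in_cone_iff _ _ _ _ _ (perm_rot _ _ _ (perm_rot _ _ _ Hp))); hsums Hp; lra. }
  destruct (climb P HP i j k v q (h j q) (h k q) Hp Hv Hq) as (x & Hx & Hxj & Hxk).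
  + lra.
  + hsums Hp; lra.
  + intros y Hy Hyv Hyq; apply (Hclear y Hy Hyv); lra.
  + intros y Hy Hyv Hyq; rewrite (in_cone_iff _ _ _ _ _ (perm_rot _ _ _ Hp)) in Hyv.
    pose proof (parent_empty P i j k c v y Hp Hc Hy); lra.
  + assert (Hxt : h k x <= h k t) by lra; specialize (Hlast x Hx Hxt).
    destruct (Rle_lt_or_eq_dec _ _ Hlast) as [Hlt|Heq].
    * pose proof (siblings_order P HP i j k x c v Hp Hx Hc Hlt); lra.
    * rewrite (h_inj P HP k x c (proj1 Hx) HcP Heq) in Hxj; lra.
Qed.

(** Side [j] is occupied, since otherwise a climb from [t] would give a child not beyond [t]. A
    point violating the new [clear] contradicts the old one, the minimality of [u], or, by a climb,
    the absence of such children. *)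
Lemma parent_inside i j k v : perm i j k -> In v P -> in_cone i t v -> clear P t v k ->
  (forall c, parent P i c v -> h k c <= h k t -> False) ->
  exists u, parent P j v u /\ h j u < h j t /\ clear P t u k.
Proof.
intros Hp Hv Htv Hclear Hno.
assert (Hj : exists q, In q P /\ in_cone j v q /\ h j q < h j t).
{ apply NNPP; intros Hn.
  destruct (child_inside i j k v Hp Hv Htv) as (c & Hc & _ & Hck); [|assumption|eauto].
  intros q Hq Hqv Hqt; apply Hn; eauto. }
destruct Hj as (w & HwP & Hw & Hwt).
destruct (parent_exists P j v w Hv HwP Hw) as (u & Hu & Huw).
exists u; split; [assumption|]; split; [lra|].
assert (Hu' := Hu); destruct Hu' as (_ & HuP & Hu' & Hum).
rewrite (in_cone_iff _ _ _ _ _ (perm_rot _ _ _ Hp)) in Hu'.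
intros q Hq Hqu Hqt.
rewrite (in_cone_iff _ _ _ _ _ (perm_rot _ _ _ (perm_rot _ _ _ Hp))) in Hqu.
assert (Hqv : q <> v) by (intros ->; hsums Hp; lra).
destruct (separated_lt_or P HP q v j Hq Hv Hqv) as [Hqj|Hqj].
{ apply (Hclear q Hq); [|assumption].
  apply (in_cone_iff _ _ _ _ _ (perm_rot _ _ _ (perm_rot _ _ _ Hp))); lra. }
destruct (separated_lt_or P HP q v k Hq Hv Hqv) as [Hqk|Hqk].
{ assert (h j u <= h j q); [|lra].
  apply Hum; [assumption|apply (in_cone_iff _ _ _ _ _ (perm_rot _ _ _ Hp)); lra]. }
destruct (climb P HP i j k v q (h j q) (h k q) Hp Hv Hq) as (x & Hx & Hxj & Hxk).
- lra.
- lra.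
- intros y Hy Hyv Hyq; apply (Hclear y Hy Hyv); lra.
- intros y Hy Hyv Hyq; specialize (Hum y Hy Hyv); lra.
- apply (Hno x Hx); lra.
Qed.

Lemma reach_up i v u m L : v <> t -> parent P i v u ->
  move (known P v) v t m = go_up (known P v) v (known P v (Parent i)) ->
  reach P t u Decide L -> reach P t v m (L + 3 * (h i u - h i v)).
Proof.
intros Hn Hu Hm Hr.
assert (Hk : parent P i v (known P v (Parent i))) by (apply (pick_spec (parent P _ v)); eauto).
rewrite (parent_unique P HP i v _ _ Hk Hu) in Hm.
apply (reach_same_move _ _ _ (Up u)); [rewrite Hm; reflexivity|].
apply simulate_up; assumption.
Qed.

Definition cost_clear (i j : idx) (v : point) : R :=
  3 * ((h i v - h i t) + (h j t - h j v)).

Definition cost_any (i j : idx) (v : point) : R :=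
  3 * (2 * (h i v - h i t) + (h j t - h j v)).

(** Both choices of [j] are covered, so the second bound holds with the smaller gap. *)
Definition routable (i : idx) (v : point) : Prop :=
  forall j k, perm i j k ->
    (clear P t v k -> reach P t v Decide (cost_clear i j v)) /\
    reach P t v Decide (cost_any i j v).

(** A descent to a child is paid by the decrease of [h i], a move to the parent in cone [j] by the
    increase of [h j]; the other term of [cost_clear] does not grow. *)
Lemma hug_reach i j k v : perm i j k -> In v P -> in_cone i t v -> clear P t v k ->
  (forall u, In u P -> h i u < h i v -> u = t \/ in_cone i t u -> routable i u) ->
  move (known P v) v t Decide = hug (known P v) v t i k ->
  reach P t v Decide (cost_clear i j v).
Proof.
intros Hp Hv Htv Hclear IH Hmove.
assert (Hne : v <> t) by (intros ->; exact (in_cone_ne _ _ _ Htv eq_refl)).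
assert (Htv' := Htv); rewrite (in_cone_iff _ _ _ _ _ Hp) in Htv'.
unfold hug in Hmove; rewrite (third_perm i j k Hp) in Hmove.
destruct (decide _) as [[H1 H2]|Hno].
- destruct (pick_cases (first_child P i k v) v) as [He|[Hc1 _]];
    change (pick _ _) with (known P v (First i k)) in *; [rewrite He in H1; lra|].
  destruct (last_child i j k v _ Hp Hv Htv Hclear Hc1 H2)
    as (c & Hc & Hct & Hlast & Hcj & Hclear').
  pose proof (pick_spec _ v (closest_child_exists P i c v Hc)) as Hcl.
  change (pick _ _) with (known P v (Closest i)) in Hcl.
  destruct (closest_child_span P HP i j k v _ c Hp Hcl Hc) as [_ Hcost].
  assert (Hc' := Hc); destruct Hc' as (HcP & _ & Hc' & _).
  rewrite (in_cone_iff _ _ _ _ _ Hp) in Hc'.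
  apply (reach_move _ _ _ _ _ _ _ Hne Hmove).
  + exists i; auto.
  + assumption.
  + apply (reach_le _ _ _ _ (cost_clear i j c + span j k (known P v (Closest i)) c)).
    * apply (go_down_reach P HP t i j k v c); try assumption; [|apply Hcl].
      apply (IH c HcP) with (k := k); try assumption; [hsums Hp; lra|].
      apply (inside_cone i j k); assumption.
    * assert (span j k (known P v (Closest i)) c = span j k c (known P v (Closest i))) as ->.
      { unfold span; f_equal; apply Rabs_minus_sym. }
      unfold cost_clear; hsums Hp; lra.
- destruct (parent_inside i j k v Hp Hv Htv Hclear) as (u & Hu & Hut & Hclear').
  { intros c Hc Hct; apply Hno.
    destruct (finite_min_child P i v (h k) (fun _ => True)) as (c1 & Hc1 & _ & Hm); [eauto|].
    assert (Hf : first_child P i k v (known P v (First i k))).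
    { apply (pick_spec (first_child P i k v)); exists c1; split; auto. }
    destruct Hf as [Hf Hfm]; specialize (Hfm c Hc).
    destruct Hf as (_ & _ & Hf & _); rewrite (in_cone_iff _ _ _ _ _ Hp) in Hf; lra. }
  assert (Hu' := Hu); destruct Hu' as (_ & HuP & Hu' & _).
  rewrite (in_cone_iff _ _ _ _ _ (perm_rot _ _ _ Hp)) in Hu'.
  apply (reach_le _ _ _ _ (cost_clear i j u + 3 * (h j u - h j v))).
  + apply (reach_up j); try assumption.
    apply (IH u HuP) with (k := k); try assumption; [hsums Hp; lra|].
    apply (inside_cone i j k); lra || assumption.
  + unfold cost_clear; hsums Hp; lra.
Qed.

Lemma route_negative i v : In v P -> in_cone i t v -> routable i v.
Proof.
intros HvP; pattern v; apply (finite_ind P (h i)); [clear v HvP|assumption].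
intros v HvP IHv Htv.
assert (IH : forall u, In u P -> h i u < h i v -> u = t \/ in_cone i t u -> routable i u).
{ intros u Hu Huv [->|Hut]; [|apply IHv; assumption].
  intros j k Hp; split; intros; apply reach_stop; unfold cost_clear, cost_any; lra. }
clear IHv; intros j0 k0 Hp0.
assert (Hne : v <> t) by (intros ->; exact (in_cone_ne _ _ _ Htv eq_refl)).
assert (Hmove : move (known P v) v t Decide = choose (known P v) v t) by reflexivity.
unfold choose in Hmove.
rewrite (which_cone_opp i t v Htv), (which_cone i t v Htv) in Hmove.
assert (Hpos : forall j k, perm i j k -> 0 < gap v t j).
{ intros j k Hp; rewrite (in_cone_iff _ _ _ _ _ Hp) in Htv; unfold gap; lra. }
destruct (which _) as [k|] eqn:Ek.
- apply which_some in Ek; destruct Ek as (Hki & Hkc & Hkj).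
  pose proof (perm_third i k ltac:(congruence)) as Hp; set (j := third i k) in *.
  apply not_occupied in Hkc; [|assumption].
  assert (Hr : reach P t v Decide (cost_clear i j v)) by (apply (hug_reach i j k); assumption).
  pose proof (Hpos j k Hp) as H1; pose proof (Hpos k j (perm_swap _ _ _ Hp)) as H2.
  split; [intros Hclear|]; apply (reach_le _ _ _ _ _ _ Hr).
  + destruct (perm_cover _ _ _ k0 Hp) as [->|[->| ->]].
    * destruct Hp0 as (? & ? & ?); congruence.
    * apply not_occupied in Hclear; [|assumption]; specialize (Hkj Hclear).
      assert (j0 = k) as ->.
      { rewrite <- (third_perm i j0 j Hp0); apply third_perm, perm_swap, Hp. }
      unfold cost_clear, gap in *; lra.
    * assert (j0 = j) as -> by (symmetry; apply third_perm, Hp0); lra.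
  (* The two gaps sum to [h i v - h i t], so the second copy of this side in [cost_any] covers the
     gap on side [j] even if [j0] is the other side. *)
  + pose proof (Hpos j0 k0 Hp0) as H3.
    unfold cost_clear, cost_any, gap in *; hsums Hp; lra.
- pose proof (which_none _ Ek) as Hnone; cbv beta in Hnone; clear Ek.
  (* A single clear side would have been selected, and of two clear sides one has the larger gap. *)
  assert (Hocc : forall k j, perm i j k -> ~ clear P t v k).
  { intros k j Hp Hclear; pose proof (perm_swap _ _ _ Hp) as Hp'.
    assert (Hik : i <> k /\ i <> j) by (destruct Hp as (? & ? & ?); auto).
    apply (Hnone k); split; [intuition|]; rewrite (third_perm i j k Hp).
    split; [apply not_occupied; assumption|].
    intros Hj; apply Rnot_lt_le; intros Hlt; apply (Hnone j); split; [intuition|].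
    rewrite (third_perm i k j Hp'); split; [assumption|]; lra. }
  split; [intros Hclear; exfalso; exact (Hocc k0 j0 Hp0 Hclear)|].
  destruct (decide _) as [Hch|Hch].
  + assert (Hcl : closest_child P i v (known P v (Closest i))).
    { destruct (pick_cases (closest_child P i v) v) as [He|Hcl]; [|exact Hcl].
      change (pick _ _) with (known P v (Closest i)) in He; rewrite He in Hch; lra. }
    set (c := known P v (Closest i)) in *.
    destruct (closest_child_span P HP i j0 k0 v c c Hp0 Hcl (proj1 Hcl)) as [Hd _].
    assert (Hc := proj1 Hcl); assert (HcP := proj1 Hc).
    apply (reach_move _ _ _ _ _ _ _ Hne Hmove); [exists i; auto|exact I|].
    apply (reach_le _ _ _ _ (cost_any i j0 c)).
    * apply (IH c HcP Hch) with (k := k0); [|assumption].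
      (* A closest child outside the triangle would make one of the sides clear. *)
      apply (inside_cone i j0 k0); try assumption; apply Rnot_lt_le; intros Hlt.
      -- apply (Hocc j0 k0 (perm_swap _ _ _ Hp0)), (clear_of_child i j0 k0 c); assumption.
      -- apply (Hocc k0 j0 Hp0), (clear_of_child i k0 j0 c); try assumption.
         apply perm_swap, Hp0.
    * destruct Hc as (_ & _ & Hc & _); rewrite (in_cone_iff _ _ _ _ _ Hp0) in Hc.
      unfold cost_any; hsums Hp0; lra.
  + destruct (which _) as [j|] eqn:Ej.
    * apply which_some in Ej; destruct Ej as [Hji Hjk].
      pose proof (perm_swap _ _ _ (perm_third i j ltac:(congruence))) as Hp.
      set (k := third i j) in *.
      assert (Hno : ~ clear P t v j) by (apply (Hocc j k), perm_swap, Hp).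
      rewrite <- not_occupied in Hno by assumption; apply NNPP in Hno.
      unfold occupied in Hno.
      assert (Hu : parent P j v (known P v (Parent j))).
      { destruct (pick_cases (parent P j v) v) as [He|Hu]; [|exact Hu].
        change (pick _ _) with (known P v (Parent j)) in He.
        rewrite He in Hno; lra. }
      set (u := known P v (Parent j)) in *.
      assert (Hu' := Hu); destruct Hu' as (_ & HuP & Hu' & _).
      rewrite (in_cone_iff _ _ _ _ _ (perm_rot _ _ _ Hp)) in Hu'.
      assert (Htv' := Htv); rewrite (in_cone_iff _ _ _ _ _ Hp) in Htv'.
      apply (reach_le _ _ _ _ (cost_any i j u + 3 * (h j u - h j v))).
      -- apply (reach_up j); try assumption.
         apply (IH u HuP) with (k := k); [lra| |assumption].
         apply (inside_cone i j k); lra || assumption.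
      -- assert (Hmin : gap v t j <= gap v t j0).
         { destruct (perm_cover _ _ _ j0 Hp) as [->|[->| ->]]; [|lra|lra].
           destruct Hp0 as (? & ? & ?); congruence. }
         unfold cost_any, gap in *; hsums Hp; lra.
    * exfalso; pose proof (which_none _ Ej) as Hno; cbv beta in Hno.
      assert (Hik : i <> k0 /\ i <> j0) by (destruct Hp0 as (? & ? & ?); auto).
      apply (Hno j0); split; [intuition|]; apply Rnot_lt_le; intros Hlt.
      apply (Hno k0); split; [intuition|].
      rewrite (third_perm i j0 k0 Hp0).
      rewrite (third_perm i k0 j0 (perm_swap _ _ _ Hp0)) in Hlt; lra.
Qed.

(** While the parent [u] stays inside, [t] remains in cone [i]. Once [u] passes [t] sideways, [t]
    lies in a negative cone of [u], and the empty triangle of the edge from [v] to [u] makes one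
    side clear, so the cheaper negative bound applies. *)
Lemma route_positive i j k v : perm i j k -> In v P -> in_cone i v t ->
  reach P t v Decide (3 * ((h i t - h i v) + Rmax (h j v - h j t) (h k v - h k t))).
Proof.
intros Hp HvP; pattern v; apply (finite_ind P (fun v => - h i v)); [clear v HvP|assumption].
intros v HvP IH Hvt.
assert (Hne : v <> t) by (apply (in_cone_ne _ _ _ Hvt)).
assert (Hmove : move (known P v) v t Decide =
                go_up (known P v) v (known P v (Parent i))).
{ simpl; unfold choose; rewrite (which_cone i v t Hvt); reflexivity. }
destruct (parent_exists P i v t HvP Ht Hvt) as (u & Hu & Hut).
pose proof (reach_up i v u Decide) as Hup.
assert (Hu' := Hu); destruct Hu' as (_ & HuP & Hu' & Hum).
rewrite (in_cone_iff _ _ _ _ _ Hp) in Hu'; assert (Hvt' := Hvt).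
rewrite (in_cone_iff _ _ _ _ _ Hp) in Hvt'.
pose proof (Rmax_l (h j v - h j t) (h k v - h k t)) as Hml.
pose proof (Rmax_r (h j v - h j t) (h k v - h k t)) as Hmr.
destruct (classic (u = t)) as [->|Hn].
{ apply (reach_le _ _ _ _ (0 + 3 * (h i t - h i v))); [|lra].
  apply Hup; try assumption; apply reach_stop; lra. }
assert (Hside : forall j k, perm i j k -> h j v > h j t -> h k u < h k v -> h j u < h j t ->
  reach P t u Decide (cost_clear k i u)).
{ clear j k Hp Hu' Hvt' Hml Hmr IH; intros j k Hp Hj Hk Hjt.
  assert (Hiu : h i u < h i t) by (destruct (separated_lt_or P HP u t i); auto; lra).
  apply (route_negative k u) with (k := j); try assumption.
  - apply (in_cone_iff _ _ _ _ _ (perm_rot _ _ _ (perm_rot _ _ _ Hp))); auto.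
  - apply perm_rot, perm_rot, Hp.
  - intros q Hq Hqu Hqt; rewrite (in_cone_iff _ _ _ _ _ (perm_rot _ _ _ Hp)) in Hqu.
    assert (h i u <= h i q); [|lra].
    apply Hum; [assumption|]; apply (in_cone_iff _ _ _ _ _ Hp); lra. }
destruct (separated_lt_or P HP u t j HuP Ht Hn) as [Hj|Hj].
{ apply (reach_le _ _ _ _ (cost_clear k i u + 3 * (h i u - h i v))).
  - apply Hup; try assumption; apply (Hside j k); lra || assumption.
  - unfold cost_clear; hsums Hp; lra. }
destruct (separated_lt_or P HP u t k HuP Ht Hn) as [Hk|Hk].
{ apply (reach_le _ _ _ _ (cost_clear j i u + 3 * (h i u - h i v))).
  - apply Hup; try assumption; apply (Hside k j); try lra; apply perm_swap, Hp.
  - unfold cost_clear; hsums Hp; lra. }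
eapply reach_le.
- apply Hup; try assumption; apply IH; [assumption|hsums Hp; lra|].
  apply (in_cone_iff _ _ _ _ _ Hp); auto.
- assert (Rmax (h j u - h j t) (h k u - h k t) <= Rmax (h j v - h j t) (h k v - h k t)).
  { apply Rmax_lub; lra. }
  lra.
Qed.

End Routing.

(** * Translation of sectors and projections into cone coordinates *)

Definition pos_sector (i : idx) : nat := match i with I0 => 1 | I1 => 3 | I2 => 5 end.
Definition neg_sector (i : idx) : nat := match i with I0 => 4 | I1 => 0 | I2 => 2 end.

Lemma sqrt3_pos : 0 < sqrt 3.
Proof. apply sqrt_lt_R0; lra. Qed.

Lemma sqrt3_sqr : sqrt 3 * sqrt 3 = 3.
Proof. apply sqrt_sqrt; lra. Qed.

(** Opposite rays, like opposite bisectors, differ by 3 in index, so three of each are evaluated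
    explicitly. *)
Lemma ray_opp j : ray (3 + j) = (- fst (ray j), - snd (ray j)).
Proof.
unfold ray; rewrite plus_INR.
replace ((INR 3 + INR j) * PI / 3) with (INR j * PI / 3 + PI) by (simpl; field).
rewrite neg_cos, neg_sin; reflexivity.
Qed.

Lemma bisector_opp j : bisector (3 + j) = (- fst (bisector j), - snd (bisector j)).
Proof.
unfold bisector; rewrite plus_INR.
replace ((2 * (INR 3 + INR j) + 1) * PI / 6) with ((2 * INR j + 1) * PI / 6 + PI)
  by (simpl; field).
rewrite neg_cos, neg_sin; reflexivity.
Qed.

Lemma rays : ray 0 = (1, 0) /\ ray 1 = (1 / 2, sqrt 3 / 2) /\ ray 2 = (-1 / 2, sqrt 3 / 2).
Proof.
unfold ray; simpl; repeat split.
- replace (0 * PI / 3) with 0 by field; rewrite cos_0, sin_0; reflexivity.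
- replace (1 * PI / 3) with (PI / 3) by field; rewrite cos_PI3, sin_PI3; reflexivity.
- replace ((1 + 1) * PI / 3) with (2 * (PI / 3)) by field.
  rewrite cos_2PI3, sin_2PI3; reflexivity.
Qed.

Lemma bisectors : bisector 0 = (sqrt 3 / 2, 1 / 2) /\ bisector 1 = (0, 1) /\
  bisector 2 = (- (sqrt 3 / 2), 1 / 2).
Proof.
unfold bisector; simpl; repeat split.
- replace ((2 * 0 + 1) * PI / 6) with (PI / 6) by field; rewrite cos_PI6, sin_PI6; reflexivity.
- replace ((2 * 1 + 1) * PI / 6) with (PI / 2) by field; rewrite cos_PI2, sin_PI2; reflexivity.
- replace ((2 * (1 + 1) + 1) * PI / 6) with (- (PI / 6) + PI) by field.
  rewrite neg_cos, neg_sin, cos_neg, sin_neg, cos_PI6, sin_PI6; f_equal; field.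
Qed.

Lemma cross_ray w :
  cross (ray 0) w = sqrt 3 / 2 * h I0 w /\ cross (ray 1) w = - (sqrt 3 / 2 * h I2 w) /\
  cross (ray 2) w = sqrt 3 / 2 * h I1 w.
Proof.
pose proof sqrt3_pos; destruct rays as (-> & -> & ->); unfold cross, h; simpl.
repeat split; field; lra.
Qed.

Lemma dot_bisector w :
  dot w (bisector 0) = - (sqrt 3 / 2 * h I1 w) /\ dot w (bisector 1) = sqrt 3 / 2 * h I0 w /\
  dot w (bisector 2) = - (sqrt 3 / 2 * h I2 w).
Proof.
pose proof sqrt3_pos; destruct bisectors as (-> & -> & ->); unfold dot, h; simpl.
repeat split; field; lra.
Qed.

Lemma cross_ray_opp j w : cross (ray (3 + j)) w = - cross (ray j) w.
Proof. rewrite ray_opp; unfold cross; simpl; ring. Qed.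

Lemma dot_bisector_opp j w : dot w (bisector (3 + j)) = - dot w (bisector j).
Proof. rewrite bisector_opp; unfold dot; simpl; ring. Qed.

Lemma cross_opp a b : cross a b = - cross b a.
Proof. unfold cross; ring. Qed.

Lemma h_vsub i u v : h i (vsub v u) = h i v - h i u.
Proof. pose proof sqrt3_pos; destruct i; unfold h, vsub; simpl; field; lra. Qed.

Lemma scaled_pos x : 0 < sqrt 3 / 2 * x <-> 0 < x.
Proof.
pose proof sqrt3_pos; split; intros Hx; [|apply Rmult_lt_0_compat; lra].
apply (Rmult_lt_reg_l (sqrt 3 / 2)); lra.
Qed.

Lemma in_sector_cross k u v a b :
  cross (ray k) (vsub v u) = sqrt 3 / 2 * a ->
  cross (ray (S k)) (vsub v u) = - (sqrt 3 / 2 * b) ->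
  in_sector k u v <-> 0 < a /\ 0 < b.
Proof.
intros Ha Hb; unfold in_sector; rewrite (cross_opp (vsub v u)), Ha, Hb, Ropp_involutive.
rewrite !scaled_pos; reflexivity.
Qed.

Lemma in_sector_pos i u v : in_sector (pos_sector i) u v <-> in_cone i u v.
Proof.
pose proof (cross_ray (vsub v u)) as (R0 & R1 & R2).
pose proof (cross_ray_opp 0 (vsub v u)) as R3; pose proof (cross_ray_opp 1 (vsub v u)) as R4.
pose proof (cross_ray_opp 2 (vsub v u)) as R5; pose proof (cross_ray_opp 3 (vsub v u)) as R6.
rewrite !h_vsub in *; simpl in R3, R4, R5, R6; destruct i; simpl pos_sector.
- rewrite (in_cone_iff I0 I1 I2) by (repeat split; discriminate).
  rewrite (in_sector_cross 1 u v (h I2 u - h I2 v) (h I1 u - h I1 v)); lra.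
- rewrite (in_cone_iff I1 I0 I2) by (repeat split; discriminate).
  rewrite (in_sector_cross 3 u v (h I0 u - h I0 v) (h I2 u - h I2 v)); lra.
- rewrite (in_cone_iff I2 I0 I1) by (repeat split; discriminate).
  rewrite (in_sector_cross 5 u v (h I1 u - h I1 v) (h I0 u - h I0 v)); lra.
Qed.

Lemma in_sector_neg i u v : in_sector (neg_sector i) u v <-> in_cone i v u.
Proof.
pose proof (cross_ray (vsub v u)) as (R0 & R1 & R2).
pose proof (cross_ray_opp 0 (vsub v u)) as R3; pose proof (cross_ray_opp 1 (vsub v u)) as R4.
pose proof (cross_ray_opp 2 (vsub v u)) as R5.
rewrite !h_vsub in *; simpl in R3, R4, R5; destruct i; simpl neg_sector.
- rewrite (in_cone_iff I0 I1 I2) by (repeat split; discriminate).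
  rewrite (in_sector_cross 4 u v (h I2 v - h I2 u) (h I1 v - h I1 u)); lra.
- rewrite (in_cone_iff I1 I0 I2) by (repeat split; discriminate).
  rewrite (in_sector_cross 0 u v (h I0 v - h I0 u) (h I2 v - h I2 u)); lra.
- rewrite (in_cone_iff I2 I0 I1) by (repeat split; discriminate).
  rewrite (in_sector_cross 2 u v (h I1 v - h I1 u) (h I0 v - h I0 u)); lra.
Qed.

Lemma proj_pos i u v : proj (pos_sector i) u v = sqrt 3 / 2 * (h i v - h i u).
Proof.
rewrite <- h_vsub; unfold proj; pose proof (dot_bisector (vsub v u)) as (B0 & B1 & B2).
pose proof (dot_bisector_opp 0 (vsub v u)) as B3; pose proof (dot_bisector_opp 2 (vsub v u)) as B5.
simpl in B3, B5; destruct i; simpl pos_sector; lra.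
Qed.

Lemma proj_neg i u v : proj (neg_sector i) u v = sqrt 3 / 2 * (h i u - h i v).
Proof.
replace (h i u - h i v) with (- h i (vsub v u)) by (rewrite h_vsub; ring).
unfold proj; pose proof (dot_bisector (vsub v u)) as (B0 & B1 & B2).
pose proof (dot_bisector_opp 1 (vsub v u)) as B4.
simpl in B4; destruct i; simpl neg_sector; lra.
Qed.

Lemma positive_sector_iff k : positive_sector k <-> exists i, k = pos_sector i.
Proof.
unfold positive_sector; split.
- intros [->|[->| ->]]; [exists I0|exists I1|exists I2]; reflexivity.
- intros [[] ->]; simpl; auto.
Qed.

Lemma negative_neg_sector i : negative_sector (neg_sector i).
Proof. unfold negative_sector; destruct i; simpl; auto. Qed.

Lemma general_position_separated P : general_position P -> separated P.
Proof.
intros HG p q Hp Hq Hn i Hi.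
pose proof (cross_ray (vsub q p)) as (R0 & R1 & R2); rewrite !h_vsub in *.
specialize (HG p q Hp Hq Hn); setoid_rewrite cross_opp in HG.
destruct i.
- apply (HG 0%nat); [lia|]; rewrite R0, Hi; ring.
- apply (HG 2%nat); [lia|]; rewrite R2, Hi; ring.
- apply (HG 1%nat); [lia|]; rewrite R1, Hi; ring.
Qed.

Lemma scaled_le x y : sqrt 3 / 2 * x <= sqrt 3 / 2 * y <-> x <= y.
Proof.
pose proof sqrt3_pos; split; intros Hx; [|apply Rmult_le_compat_l; lra].
apply (Rmult_le_reg_l (sqrt 3 / 2)); lra.
Qed.

Lemma H_dir_parent P u v : H_dir P u v <-> exists i, parent P i u v.
Proof.
unfold H_dir, parent; split.
- intros (Hu & Hv & k & Hk & Hs & Hm); apply positive_sector_iff in Hk as [i ->].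
  apply in_sector_pos in Hs; exists i; repeat split; try assumption.
  intros y Hy Hc; specialize (Hm y Hy (proj2 (in_sector_pos i u y) Hc)).
  rewrite !proj_pos, scaled_le in Hm; lra.
- intros (i & Hu & Hv & Hc & Hm); repeat split; try assumption.
  exists (pos_sector i); split; [apply positive_sector_iff; eauto|].
  split; [apply in_sector_pos, Hc|]; intros x Hx Hs; apply in_sector_pos in Hs.
  rewrite !proj_pos, scaled_le; specialize (Hm x Hx Hs); lra.
Qed.

Lemma nbr_in_parent P i u v : nbr_in P u (neg_sector i) v <-> parent P i v u.
Proof.
unfold nbr_in, H_edge; rewrite !H_dir_parent, in_sector_neg; split.
- intros [[(i' & Hp)|(i' & Hp)] Hc].
  + exfalso; exact (in_cone_opp _ _ _ _ (proj1 (proj2 (proj2 Hp))) Hc).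
  + rewrite (in_cone_inj _ _ _ _ Hc (proj1 (proj2 (proj2 Hp)))); assumption.
- intros Hp; split; [right; eauto|apply Hp].
Qed.

Lemma closest_nbr_child P i u c : closest_child P i u c -> closest_nbr P u (neg_sector i) c.
Proof.
intros [Hc Hm]; split; [apply nbr_in_parent, Hc|].
intros x Hx; apply nbr_in_parent, Hm in Hx; rewrite !proj_neg, scaled_le; lra.
Qed.

(** * Angular order, and the links as edges of both graphs *)

Lemma cross_h i j k : perm i j k ->
  (forall a b, cross a b = sqrt 3 / 2 * (h j a * h k b - h k a * h j b)) \/
  (forall a b, cross a b = - (sqrt 3 / 2 * (h j a * h k b - h k a * h j b))).
Proof.
pose proof sqrt3_pos; pose proof sqrt3_sqr as Hs; intros (? & ? & ?).
destruct i, j, k; try congruence; [left|right|right|left|left|right];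
  intros a b; unfold cross, h; field; lra.
Qed.

Section Angles.
Context (P : list point) (HP : separated P).

(** Angular order around [u] is the order of [h k] or its reverse, depending on
    the orientation of [(i, j, k)]. *)
Lemma ang_lt_siblings i j k : perm i j k ->
  (forall u a b, parent P i a u -> parent P i b u -> (ang_lt u a b <-> h k a < h k b)) \/
  (forall u a b, parent P i a u -> parent P i b u -> (ang_lt u a b <-> h k b < h k a)).
Proof.
intros Hp.
assert (Hmain : forall u a b, parent P i a u -> parent P i b u -> h k a < h k b ->
  0 < h j (vsub a u) * h k (vsub b u) - h k (vsub a u) * h j (vsub b u)).
{ intros u a b Ha Hb Hk; rewrite !h_vsub.
  pose proof (siblings_order P HP i j k a b u Hp Ha Hb Hk) as Hj.
  destruct Ha as (_ & _ & Ha & _), Hb as (_ & _ & Hb & _).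
  rewrite (in_cone_iff _ _ _ _ _ Hp) in Ha; rewrite (in_cone_iff _ _ _ _ _ Hp) in Hb.
  apply Rlt_0_minus; rewrite Rmult_comm; apply Rmult_gt_0_lt_compat; lra. }
assert (Hiff : forall u a b, parent P i a u -> parent P i b u ->
  (0 < h j (vsub a u) * h k (vsub b u) - h k (vsub a u) * h j (vsub b u) <-> h k a < h k b)).
{ intros u a b Ha Hb; split; [|apply Hmain; assumption]; intros Hx.
  apply Rnot_le_lt; intros Hba; destruct (Rle_lt_or_eq_dec _ _ Hba) as [Hlt|Heq].
  - specialize (Hmain u b a Hb Ha Hlt); lra.
  - rewrite (h_inj P HP k b a (proj1 Hb) (proj1 Ha) Heq) in Hx; lra. }
unfold ang_lt; destruct (cross_h i j k Hp) as [Hc|Hc]; [left|right];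
  intros u a b Ha Hb; rewrite Hc.
- rewrite scaled_pos; auto.
- rewrite <- Ropp_mult_distr_r_reverse, scaled_pos, <- (Hiff u b a Hb Ha); split; lra.
Qed.

Lemma next_sibling_swap i j k a b : perm i j k ->
  next_sibling P i k a b -> next_sibling P i j b a.
Proof.
intros Hp (u & Ha & Hb & Hk & Hm); exists u; split; [assumption|]; split; [assumption|].
split; [apply (siblings_order P HP i j k a b u); assumption|].
intros z Hz Hbz.
pose proof (siblings_order P HP i k j b z u (perm_swap _ _ _ Hp) Hb Hz Hbz) as Hzk.
assert (Hza : h k z <= h k a).
{ apply Rnot_lt_le; intros Hlt; specialize (Hm z Hz Hlt); lra. }
destruct (Rle_lt_or_eq_dec _ _ Hza) as [Hlt|Heq].
- pose proof (siblings_order P HP i j k z a u Hp Hz Ha Hlt); lra.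
- rewrite (h_inj P HP k z a (proj1 Hz) (proj1 Ha) Heq); lra.
Qed.

Lemma next_sibling_consec i k a b : k <> i -> next_sibling P i k a b ->
  exists u, consec P u (neg_sector i) a b \/ consec P u (neg_sector i) b a.
Proof.
intros Hki (u & Ha & Hb & Hk & Hm); exists u.
assert (Hno : forall x, parent P i x u -> h k a < h k x -> h k x < h k b -> False).
{ intros x Hx Hax Hxb; specialize (Hm x Hx Hax); lra. }
unfold consec; setoid_rewrite nbr_in_parent.
destruct (ang_lt_siblings i (third i k) k (perm_third i k (not_eq_sym Hki))) as [Ho|Ho];
  [left|right]; repeat (split; [assumption || (apply Ho; assumption)|]);
  intros (x & Hx & H1 & H2); apply Ho in H1; try assumption; apply Ho in H2; try assumption;
  apply (Hno x); assumption.
Qed.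

(** In [G9] the edge lies on a canonical path. In [G12] it survives because one of the siblings is
    the parent of the other, which is extreme among its children. *)
Lemma next_sibling_edges i k a b : k <> i -> next_sibling P i k a b ->
  (G9 P a b /\ G9 P b a) /\ (G12 P a b /\ G12 P b a).
Proof.
intros Hki Hab; set (j := third i k).
pose proof (perm_third i k (not_eq_sym Hki)) as Hp; fold j in Hp.
assert (Hextreme : forall j k a b, perm i j k -> next_sibling P i k a b -> parent P j b a ->
          extreme_nbr P a (neg_sector j) b).
{ clear k Hki j Hp a b Hab; intros j k a b Hp Hab Hba.
  assert (Hlt : forall x, parent P j x a -> x <> b -> h i x < h i b).
  { intros x Hx Hxb; pose proof (next_sibling_extreme P HP i j k a b x Hp Hab Hba Hx).
    destruct (separated_lt_or P HP x b i (proj1 Hx) (proj1 Hba) Hxb); lra. }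
  split; [apply nbr_in_parent, Hba|].
  destruct (ang_lt_siblings j k i (perm_rot _ _ _ Hp)) as [Ho|Ho]; [left|right];
    intros x Hx Hxb; apply nbr_in_parent in Hx; apply Ho; auto. }
assert (HH : (H_edge P a b /\ H_edge P b a) /\
  exists u v k, negative_sector k /\ (u = a /\ v = b \/ u = b /\ v = a) /\ extreme_nbr P u k v).
{ unfold H_edge; rewrite !H_dir_parent.
  destruct (next_sibling_parent P HP i j k a b Hp Hab) as [Hba|Hba].
  - split; [split; [right|left]; exists j; assumption|]; exists a, b, (neg_sector j).
    split; [apply negative_neg_sector|]; split; [auto|]; apply (Hextreme j k); assumption.
  - split; [split; [left|right]; exists k; assumption|]; exists b, a, (neg_sector k).
    split; [apply negative_neg_sector|]; split; [auto|].
    apply (Hextreme k j); [apply perm_swap, Hp|apply (next_sibling_swap i j k); assumption|assumption]. }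
destruct HH as [[Hab' Hba'] (u & v & l & Hl & Huv & He)].
destruct (next_sibling_consec i k a b Hki Hab) as (w & Hw).
pose proof (negative_neg_sector i) as Hi.
repeat split; try assumption.
- right; exists w, (neg_sector i); auto.
- right; exists w, (neg_sector i); split; [assumption|]; destruct Hw; auto.
- exists u, v, l; auto.
- exists u, v, l; split; [assumption|]; split; [destruct Huv; auto|auto].
Qed.

Lemma closest_child_edges i u c : closest_child P i u c ->
  (G9 P u c /\ G9 P c u) /\ (G12 P u c /\ G12 P c u).
Proof.
intros Hc; pose proof (closest_nbr_child P i u c Hc) as Hn.
pose proof (negative_neg_sector i) as Hi.
assert (HH : H_edge P u c /\ H_edge P c u).
{ unfold H_edge; rewrite !H_dir_parent; assert (Hp := proj1 Hc); split; eauto. }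
destruct HH; repeat split; try assumption.
1-2: left; exists u, c, (neg_sector i); auto.
1-2: exists u, c, (neg_sector i); auto.
Qed.

Lemma link_edges a b : link P a b -> G9 P a b /\ G12 P a b.
Proof.
intros (i & [H|[H|(k & Hk & [H|H])]]);
  [apply closest_child_edges in H|apply closest_child_edges in H|
   apply next_sibling_edges in H|apply next_sibling_edges in H]; intuition.
Qed.

End Angles.

(** * Storage, memory and execution *)

Definition cones : list idx := [I0; I1; I2].
Definition num (i : idx) : nat := match i with I0 => 0 | I1 => 1 | I2 => 2 end.

Definition slots : list slot :=
  map Parent cones ++ map Toward cones ++ map Closest cones ++
  flat_map (fun i => map (First i) cones) cones ++
  flat_map (fun i => map (Sibling i) cones) cones.

(** Positions in [slots], which has 3 + 3 + 3 + 9 + 9 = 27 entries. *)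
Definition slot_index (sl : slot) : nat :=
  match sl with
  | Parent i => num i
  | Toward i => 3 + num i
  | Closest i => 6 + num i
  | First i k => 9 + 3 * num i + num k
  | Sibling i k => 18 + 3 * num i + num k
  end.

Definition recall (l : list unit_) (sl : slot) : point :=
  match nth (slot_index sl) l (UNat 0) with UPt p => p | UNat _ => (0, 0) end.

Definition remember (P : list point) (s : point) : list unit_ :=
  map (fun sl => UPt (known P s sl)) slots.

Lemma recall_remember P s : recall (remember P s) = known P s.
Proof.
apply functional_extensionality.
intros [i|i|i|i k|i k]; destruct i; try destruct k; reflexivity.
Qed.

(** The mode is encoded by the number of copies of its point. *)
Definition encode (m : mode) : list unit_ :=
  match m with
  | Decide => []
  | Up q => [UPt q]
  | Down q k => repeat (UPt q) (2 + num k)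
  end.

Definition decode (l : list unit_) : mode :=
  match l with
  | [UPt q] => Up q
  | [UPt q; _] => Down q I0
  | [UPt q; _; _] => Down q I1
  | [UPt q; _; _; _] => Down q I2
  | _ => Decide
  end.

Lemma decode_encode m : decode (encode m) = m.
Proof. destruct m as [| |q []]; reflexivity. Qed.

(** At most four copies occur, for [Down q I2]. Points are used because with two vertices the only
    valid integers are 0 and 1. *)
Lemma valid_encode P m : mode_in P m -> valid_units P 4 (encode m).
Proof.
unfold valid_units; destruct m as [|q|q []]; simpl; intros Hq; split;
  try lia; repeat constructor; assumption.
Qed.

Lemma valid_remember P s : In s P -> valid_units P 27 (remember P s).
Proof.
intros Hs; split; [unfold remember; rewrite length_map; reflexivity|].
unfold remember; apply Forall_map, Forall_forall; intros sl _; simpl.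
assert (Hpick : forall Q, (forall x, Q x -> In x P) -> In (pick Q s) P).
{ intros Q HQ; destruct (pick_cases Q s) as [->|Hx]; auto. }
destruct sl; apply Hpick; clear Hpick.
- intros x (_ & Hx & _); assumption.
- intros x (q & Hq & [[_ ->]|(k & c & _ & _ & _ & u & _ & Hx & _)]); [apply Hq|apply Hx].
- intros x [Hx _]; apply Hx.
- intros x [Hx _]; apply Hx.
- intros x (u & _ & Hx & _); apply Hx.
Qed.

Definition router : algorithm := {|
  info := remember;
  step := fun s t _ I M =>
    let '(s', m) := move (recall I) s t (decode M) in (s', encode m) |}.

Lemma run_router G P s t n v m : run G router P s t n = (v, encode m) ->
  forall v' m', move (known P v) v t m = (v', m') ->
  run G router P s t (S n) = (v', encode m').
Proof.
intros Hr v' m' Hm; change (run G router P s t (S n)) with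
  (let st := run G router P s t n in
   let '(s', m) := move (recall (remember P (fst st))) (fst st) t (decode (snd st)) in
   (s', encode m)).
rewrite Hr; simpl fst; simpl snd; cbv zeta.
rewrite recall_remember, decode_encode, Hm; reflexivity.
Qed.

(** The starting time [K] is arbitrary so that the induction can advance it. *)
Lemma reach_run G P s t v m L : (forall a b, link P a b -> G P a b) -> reach P t v m L ->
  forall K, run G router P s t K = (v, encode m) ->
  exists N, (K <= N)%nat /\ fst (run G router P s t N) = t /\
    (forall k, (K <= k < N)%nat -> fst (run G router P s t k) <> t) /\
    (forall k, (K <= k < N)%nat ->
       G P (fst (run G router P s t k)) (fst (run G router P s t (S k))) /\
       valid_units P 4 (snd (run G router P s t (S k)))) /\
    path_length G router P s t N <= path_length G router P s t K + L.
Proof.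
intros HG; induction 1 as [m L HL|v m v' m' L Hn Hm Hl Hin _ IH]; intros K HK.
- exists K; rewrite HK; simpl; repeat split; try lia; lra.
- assert (HK' := run_router G P s t K v m HK v' m' Hm).
  destruct (IH (S K) HK') as (N & HKN & Ht & Hnt & Hedge & Hlen).
  exists N; split; [lia|]; split; [assumption|].
  assert (Hstep : forall k, (K <= k < N)%nat -> k = K \/ (S K <= k < N)%nat) by lia.
  split; [|split].
  + intros k Hk; destruct (Hstep k Hk) as [->|Hk']; [rewrite HK; assumption|auto].
  + intros k Hk; destruct (Hstep k Hk) as [->|Hk']; [|auto].
    rewrite HK, HK'; split; [apply HG, Hl|apply valid_encode, Hin].
  + change (path_length G router P s t (S K)) with (path_length G router P s t K +
      dist (fst (run G router P s t K)) (fst (run G router P s t (S K)))) in Hlen.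
    rewrite HK, HK' in Hlen; simpl fst in Hlen; lra.
Qed.

Lemma reach_routes_within G P s t L : (forall a b, link P a b -> G P a b) ->
  reach P t s Decide L -> routes_within G router 4 P s t L.
Proof.
intros HG Hr; destruct (reach_run G P s t s Decide L HG Hr 0 eq_refl)
  as (N & _ & Ht & Hnt & Hedge & Hlen).
simpl in Hlen; rewrite Rplus_0_l in Hlen.
exists N; split; [assumption|]; split; [|split; [|assumption]]; intros k Hk.
- apply Hnt; lia.
- apply Hedge; lia.
Qed.

(** * From triangle sides to Euclidean distance *)

Lemma le_sqrt x y : x ^ 2 <= y -> x <= sqrt y.
Proof.
intros Hxy; apply (Rle_trans _ (Rabs x)); [apply Rle_abs|].
rewrite <- sqrt_Rsqr_abs, Rsqr_pow2; apply sqrt_le_1_alt, Hxy.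
Qed.

(** Four times the radicand exceeds the square of the left side by three times the square of the
    smaller variable. *)
Lemma positive_bound x y : 0 < x -> 0 < y ->
  x + y + Rmax x y <= 2 * sqrt (x ^ 2 + x * y + y ^ 2).
Proof.
intros Hx Hy; cut ((x + y + Rmax x y) / 2 <= sqrt (x ^ 2 + x * y + y ^ 2)); [intros; lra|].
apply le_sqrt; pose proof (pow2_ge_0 x); pose proof (pow2_ge_0 y).
unfold Rmax; destruct (Rle_dec x y); lra.
Qed.

(** The worst case is [x = y], whence [5 / sqrt 3]. Squared and cleared of denominators, the
    difference of the sides factors as [(y - x) * (13 * y + 2 * x)]. *)
Lemma negative_bound x y : 0 < x -> 0 < y -> x <= y ->
  2 * (x + y) + x <= 5 / sqrt 3 * sqrt (x ^ 2 + x * y + y ^ 2).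
Proof.
intros Hx Hy Hxy; pose proof sqrt3_pos; pose proof sqrt3_sqr as Hs.
set (D := sqrt (x ^ 2 + _ + _)); cut ((2 * (x + y) + x) * sqrt 3 / 5 <= D).
{ intros HD; replace (5 / sqrt 3 * D) with (D * 5 / sqrt 3) by (field; lra).
  apply (Rmult_le_reg_r (sqrt 3)); [assumption|].
  replace (D * 5 / sqrt 3 * sqrt 3) with (D * 5) by (field; lra); lra. }
apply le_sqrt.
replace (((2 * (x + y) + x) * sqrt 3 / 5) ^ 2)
  with ((2 * (x + y) + x) ^ 2 * (sqrt 3 * sqrt 3) / 25) by field.
rewrite Hs; assert (0 <= (y - x) * (13 * y + 2 * x)) by (apply Rmult_le_pos; lra); lra.
Qed.

Lemma routing_router (G : list point -> point -> point -> Prop) :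
  (forall P, separated P -> forall a b, link P a b -> G P a b) -> routing_claim G.
Proof.
intros HG; exists 27%nat, 4%nat, router; intros P _ HP.
apply general_position_separated in HP; split; [apply valid_remember|].
intros u w Hu Hw (l & Hl & Huw).
apply positive_sector_iff in Hl as [i ->]; apply in_sector_pos in Huw.
destruct (exists_perm i) as (j & k & Hp); assert (Huw' := Huw).
rewrite (in_cone_iff _ _ _ _ _ Hp) in Huw'; destruct Huw' as [Hj Hk].
split; apply reach_routes_within; try (apply HG; assumption).
- eapply reach_le; [apply (route_positive P HP w Hw i j k u); assumption|].
  rewrite (dist_sqr i j k u w Hp).
  pose proof (positive_bound (h j u - h j w) (h k u - h k w)); hsums Hp; lra.
- rewrite (dist_sqr i j k u w Hp).
  pose proof (negative_bound (h j u - h j w) (h k u - h k w)) as Bj.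
  pose proof (negative_bound (h k u - h k w) (h j u - h j w)) as Bk.
  replace ((h k u - h k w) ^ 2 + (h k u - h k w) * (h j u - h j w) + (h j u - h j w) ^ 2)
    with ((h j u - h j w) ^ 2 + (h j u - h j w) * (h k u - h k w) + (h k u - h k w) ^ 2)
    in Bk by ring.
  pose proof (route_negative P HP u Hu i w Hw Huw) as Hr.
  (* [negative_bound] needs the smaller gap as its first variable, which decides between the two
     instances of [cost_any]. *)
  destruct (Rle_dec (h j u - h j w) (h k u - h k w)).
  + eapply reach_le; [apply (Hr j k Hp)|]; unfold cost_any; hsums Hp; lra.
  + eapply reach_le; [apply (Hr k j (perm_swap _ _ _ Hp))|]; unfold cost_any; hsums Hp; lra.
Qed.

Theorem theorem5 : routing_claim G9 /\ routing_claim G12.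
Proof.
split; apply routing_router; intros P HP a b Hab; apply (link_edges P HP a b Hab).
Qed.
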